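(* Let $W=(w_k)_{k=1}^\infty$ be the decreasing sequence of weights on $G_1$ and $K_\infty$ the non-bornological sequence space defined in the context. Then the space $H\overline W(G_1)$ contains a complemented subspace isomorphic (as a locally convex space) to the non-bornological space $K_\infty$. In particular, $H\overline W(G_1)$ does not coincide topologically with the weighted inductive limit $\mathcal{W}H(G_1)$.
   Context: All vector spaces are over $\mathbb{C}$; $\mathbb{R}^+$ is the set of strictly positive reals, $\mathbb{N}=\{1,2,\dots\}$. The sequence $\Lambda$ and the space $K_\infty$. Let $\Lambda=(\lambda_k)_{k=1}^\infty$ be a decreasing sequence of strictly positive functions on $\mathbb{N}$, $\lambda_{nk}:=\lambda_k(n)$. Let $\overline\Lambda$ be the set of all $\overline\lambda:\mathbb{N}\to\mathbb{R}^+$ such that for every $k$ there is $C_k>0$ with $\overline\lambda\le C_k\lambda_k$ on $\mathbb{N}$, and let $K_\infty$ be the space of all complex sequences $x=(x_n)$ with $p_{\overline\lambda}(x):=\sup_n\overline\lambda(n)|x_n|<\infty$ for all $\overline\lambda\in\overline\Lambda$, topologized by the seminorms $p_{\overline\lambda}$, $\overline\lambda\in\overline\Lambda$. Throughout, $\Lambda$ is fixed such that $1/n^2\le\lambda_{nk}\le1$ for all $n,k$, and the space $K_\infty$ is not bornological and contains bounded sets which are not metrizable (such $\Lambda$ are known to exist). The weights on $G_1$. Let $G_1=\{z\in\mathbb{C}: 1/2<|z|<1,\ 0<\arg z<\pi\}$. For $n\in\mathbb{N}$ put $\theta_n=1/(2n)$, $I_n=[\theta_n-1/(2^5n^2),\theta_n+1/(2^5n^2)]$,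 $p_n=\theta_n+1/(2^4n^2)$. Define $w_k(re^{i\theta})=\hat w_k(\theta)$ for $re^{i\theta}\in G_1$, where $\hat w_k:[0,\pi]\to\mathbb{R}^+$ satisfies $\hat w_k=\lambda_{nk}$ on $I_n$ for all $n$, $\hat w_k(p_n)=\hat w_k(0)=\hat w_k(\pi)=1$ for all $n$, and $\hat w_k$ is affine on each of the remaining intervals $[\theta_n+1/(2^5n^2),p_n]$, $[p_{n+1},\theta_n-1/(2^5n^2)]$ $(n\in\mathbb{N})$ and $[p_1,\pi]$. Then $W=(w_k)$ is a decreasing sequence of continuous strictly positive weights on $G_1$. Weighted spaces. $Hw_k(G_1)$ is the Banach space of holomorphic $f:G_1\to\mathbb{C}$ with $p_{w_k}(f):=\sup_{z\in G_1}w_k(z)|f(z)|<\infty$, and $\mathcal{W}H(G_1)={\rm ind}_k\,Hw_k(G_1)$ (locally convex inductive limit). $\overline W$ is the set of all continuous $\overline w:G_1\to\mathbb{R}^+$ such that for every $k$ there is $C_k>0$ with $\overline w\le C_kw_k$ on $G_1$. $H\overline W(G_1)$ is the space of all holomorphic $f:G_1\to\mathbb{C}$ with $p_{\overline w}(f):=\sup_{z\in G_1}\overline w(z)|f(z)|<\infty$ for all $\overline w\in\overline W$, with the locally convex topology given by the seminorms $p_{\overline w}$, $\overline w\in\overline W$. It is known that $\mathcal{W}H(G_1)=H\overline W(G_1)$ as vector spaces. *)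

(* Defs.v *)
From HB Require Import structures.
From mathcomp Require Import all_boot all_order all_algebra.
From mathcomp Require Import all_classical all_reals all_analysis.
From mathcomp Require Import complex.
From mathcomp Require Import ring lra.

Set Implicit Arguments.
Unset Strict Implicit.
Unset Printing Implicit Defensive.

Import Order.TTheory GRing.Theory Num.Theory.
Import numFieldNormedType.Exports.
Import Normc.

Local Open Scope classical_set_scope.
Local Open Scope ring_scope.
Local Open Scope complex_scope.

Section LocallyConvex.
Context {K : numFieldType}.
Implicit Types E F : tvsType K.

Definition absolutely_convex E (A : set E) : Prop :=
  forall (a b : K) (x y : E), `|a| + `|b| <= 1 -> A x -> A y ->
    A (a *: x + b *: y).

Definition absorbs E (A B : set E) : Prop :=
  exists2 r : K, 0 < r & forall a : K, r <= `|a| -> B `<=` *:%R a @` A.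

Definition von_neumann_bounded E (B : set E) : Prop :=
  forall U : set E, nbhs 0 U -> absorbs U B.

Definition bornological E : Prop :=
  forall A : set E, absolutely_convex A ->
    (forall B : set E, von_neumann_bounded B -> absorbs A B) -> nbhs 0 A.

Definition complemented E (S : set E) : Prop :=
  exists P : {linear E -> E},
    [/\ continuous P, forall x, P (P x) = P x & range P = S].

(* [S] carries the topology induced by [E]. *)
Definition isomorphic_to_subspace F E (S : set E) : Prop :=
  exists (j : {linear F -> E}) (g : E -> F),
    [/\ continuous j, range j = S, cancel j g & {within S, continuous g}].

End LocallyConvex.

(* [B] carries the topology induced by [X]. *)
Definition metrizable_subset (R : realType) (X : topologicalType) (B : set X) :
    Prop :=
  exists d : B -> B -> R,
    [/\ forall x y, d x y = 0 <-> x = y,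
        forall x y, d x y = d y x,
        forall x y z, d x z <= d x y + d y z &
        forall (x : B) (U : set B),
          nbhs x U <-> exists2 e : R, 0 < e & [set y | d x y < e] `<=` U].

Section Seminorm.
Context {R : realType}.

Lemma normc_ge0 (z : R[i]) : 0 <= normc z.
Proof. by case: z => a b; exact: sqrtr_ge0. Qed.

Record seminorm (E : lmodType R[i]) := Seminorm {
  seminorm_fun :> E -> R;
  seminormD : forall x y,
    seminorm_fun (x + y) <= seminorm_fun x + seminorm_fun y;
  seminormZ : forall a x, seminorm_fun (a *: x) = normc a * seminorm_fun x }.

Section theory.
Context (E : lmodType R[i]) (p : seminorm E).

Lemma seminorm0 : p 0 = 0.
Proof. by rewrite -(scale0r 0) seminormZ normc0 mul0r. Qed.

Lemma seminormN x : p (- x) = p x.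
Proof. by rewrite -scaleN1r seminormZ normcN normc1 mul1r. Qed.

Lemma seminorm_ge0 x : 0 <= p x.
Proof.
have := seminormD p x (- x); rewrite subrr seminorm0 seminormN -mulr2n.
by rewrite pmulrn_lge0.
Qed.

End theory.
End Seminorm.

(** The locally convex space [E] with the topology generated by the seminorms
    in [P]. *)
Definition lc_space (R : realType) (E : lmodType R[i]) (P : set (seminorm E)) :
  Type := E.

Section LcSpace.
Context {R : realType} {E : lmodType R[i]} {P : set (seminorm E)}.

HB.instance Definition _ := GRing.Lmodule.on (lc_space P).

Definition lc_ball n (p : 'I_n -> seminorm E) (e : R) (x : E) : set E :=
  [set y | forall i, p i (y - x) < e].

Definition lc_nbhs (x : lc_space P) : set_system (lc_space P) :=
  [set U | exists n (p : 'I_n -> seminorm E) (e : R),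
    [/\ forall i, P (p i), 0 < e & lc_ball p e x `<=` U]].

HB.instance Definition _ := hasNbhs.Build (lc_space P) lc_nbhs.

Lemma lc_nbhs_filter (x : lc_space P) : ProperFilter (nbhs x).
Proof.
split.
  move=> [n [p [e [_ e0 sub]]]]; apply: (sub x) => i.
  by rewrite subrr seminorm0.
split.
- exists 0%N, (fun i : 'I_0 => False_rect _ (notF (ltn_ord i))), 1.
  by split => // -[].
- move=> U V [n [p [e [Pp e0 pU]]]] [m [q [f [Qp f0 qV]]]].
  exists (n + m)%N, (fun i : 'I_(n + m) =>
    match fintype.split i with inl i => p i | inr i => q i end).
  exists (Num.min e f); split => [i||y H].
  + by case: (fintype.split i) => j; [exact: Pp|exact: Qp].
  + by rewrite lt_min e0.
  + split; [apply: pU => i|apply: qV => i].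
    * have := H (unsplit (inl i)); rewrite unsplitK => /lt_le_trans; apply.
      by rewrite ge_min lexx.
    * have := H (unsplit (inr i)); rewrite unsplitK => /lt_le_trans; apply.
      by rewrite ge_min lexx orbT.
- move=> U V UV [n [p [e [Pp e0 pU]]]]; exists n, p, e; split => //.
  exact: subset_trans UV.
Qed.

Lemma lc_ball_nbhs n (p : 'I_n -> seminorm E) (e : R) (x y : lc_space P) :
  (forall i, P (p i)) -> lc_ball p e x y -> nbhs y (lc_ball p e x : set (lc_space P)).
Proof.
move=> Pp Hy.
pose d := \big[Num.min/1]_i (e - p i (y - x)).
have d0 : 0 < d.
  by apply: lt_bigmin => // i _; rewrite subr_gt0 Hy.
exists n, p, d; split => // z Hz i.
have -> : z - x = (z - y) + (y - x) by rewrite addrA subrK.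
apply: (le_lt_trans (seminormD _ _ _)); rewrite -ltrBrDr.
by apply: (lt_le_trans (Hz i)); exact: bigmin_le_cond.
Qed.

Lemma nbhs_lc_ball n (p : 'I_n -> seminorm E) (e : R) (x : lc_space P) :
  (forall i, P (p i)) -> 0 < e -> nbhs x (lc_ball p e x : set (lc_space P)).
Proof. by move=> Pp e0; exists n, p, e; split. Qed.

Lemma lc_nbhs_singleton (x : lc_space P) (A : set (lc_space P)) :
  nbhs x A -> A x.
Proof.
by move=> [n [p [e [_ e0 sub]]]]; apply: (sub x) => i; rewrite subrr seminorm0.
Qed.

Lemma lc_nbhs_nbhs (x : lc_space P) (A : set (lc_space P)) :
  nbhs x A -> nbhs x (nbhs^~ A).
Proof.
move=> [n [p [e [Pp e0 sub]]]]; exists n, p, e; split => // y.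
move=> /(lc_ball_nbhs Pp) yB; exact: (@filterS _ _ (lc_nbhs_filter y) _ _ sub yB).
Qed.

HB.instance Definition _ := Nbhs_isNbhsTopological.Build (lc_space P)
  lc_nbhs_filter lc_nbhs_singleton lc_nbhs_nbhs.

Lemma lc_add_continuous :
  continuous (fun x : lc_space P * lc_space P => x.1 + x.2).
Proof.
move=> [x y] U [n [p [e [Pp e0 sub]]]].
have e2 : 0 < e / 2 by lra.
exists (lc_ball p (e / 2) x, lc_ball p (e / 2) y).
  by split; exact: nbhs_lc_ball.
move=> [a b] [/= Ha Hb]; apply: sub => i /=.
have -> : a + b - (x + y) = (a - x) + (b - y) by rewrite opprD addrACA.
apply: (le_lt_trans (seminormD _ _ _)).
by have := Ha i; have := Hb i; lra.
Qed.

Lemma lc_scale_continuous :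
  continuous (fun z : R[i]^o * lc_space P => z.1 *: z.2).
Proof.
move=> [a x] U [n [p [e [Pp e0 sub]]]].
pose M := \big[Num.max/1]_i p i x.
have M1 : 1 <= M by exact: bigmax_ge_id.
have pM i : p i x <= M by exact: le_bigmax.
have na : 0 <= normc a by exact: normc_ge0.
pose d1 := Num.min 1 (e / (2 * M)).
pose d2 := e / (2 * (normc a + 1)).
have d1_0 : 0 < d1 by rewrite lt_min ltr01 divr_gt0//; lra.
have d2_0 : 0 < d2 by rewrite divr_gt0//; lra.
exists (ball (a : R[i]^o) d1%:C, lc_ball p d2 x).
  split; last exact: nbhs_lc_ball.
  by apply: nbhsx_ballx; rewrite ltcR.
move=> [b y] [/= Hb Hy]; apply: sub => i /=.
have -> : b *: y - a *: x = b *: (y - x) + (b - a) *: x.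
  by rewrite scalerBr scalerBl addrA subrK.
apply: (le_lt_trans (seminormD _ _ _)); rewrite !seminormZ.
have nb : normc (b - a) < d1.
  by move: Hb; rewrite -ball_normE /= distrC -ltcR.
have nb1 : normc b < normc a + 1.
  rewrite -[X in normc X](subrK a); apply: (le_lt_trans (le_normcD _ _)).
  by rewrite addrC ltrD2l; apply: (lt_le_trans nb); rewrite ge_min lexx.
have nb2 : normc (b - a) < e / (2 * M).
  by apply: (lt_le_trans nb); rewrite ge_min lexx orbT.
have nb0 : 0 <= normc b by exact: normc_ge0.
have nb3 : 0 <= normc (b - a) by exact: normc_ge0.
have -> : e = e / 2 + e / 2 by lra.
apply: ltr_leD.
  have -> : e / 2 = (normc a + 1) * d2.
    by rewrite /d2; field; apply: lt0r_neq0; lra.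
  apply: (@le_lt_trans _ _ ((normc a + 1) * p i (y - x))).
    by rewrite ler_wpM2r ?seminorm_ge0// ltW.
  by rewrite ltr_pM2l ?Hy//; lra.
have -> : e / 2 = e / (2 * M) * M by field; apply: lt0r_neq0; lra.
by apply: ler_pM => //; [exact: seminorm_ge0|exact: ltW].
Qed.

Lemma lc_locally_convex : exists2 B : set_system (lc_space P),
  (forall b, b \in B -> convex_set b) & basis B.
Proof.
exists [set U | exists n (p : 'I_n -> seminorm E) (e : R) (x : E),
    (forall i, P (p i)) /\ U = lc_ball p e x].
  move=> b /[!inE] -[n [p [e [x [Pp ->]]]]]; apply/convex_setW.
  move=> y z /set_mem Hy /set_mem Hz k k0 k1; apply/mem_set => i.
  have [t tk] : exists t : R, k%:num = t%:C.
    by apply/complex_realP; rewrite realE ltW.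
  move: k0 k1; rewrite tk ltcR => t0; rewrite (_ : 1 = 1%:C)// ltcR => t1.
  have -> : conv k y z = t%:C *: (y : E) + (1 - t)%:C *: (z : E).
    by rewrite /conv /= rmorphB /= -tk.
  have -> : t%:C *: (y : E) + (1 - t)%:C *: (z : E) - x =
      t%:C *: (y - x) + (1 - t)%:C *: (z - x) :> E.
    have tt : t%:C + (1 - t)%:C = 1 :> R[i] by rewrite -rmorphD addrC subrK.
    by rewrite !scalerBr addrACA -opprD -scalerDl tt scale1r.
  apply: (le_lt_trans (seminormD _ _ _)); rewrite !seminormZ.
  rewrite /= expr0n/= !addr0 !sqrtr_sqr !gtr0_norm ?subr_gt0//.
  by have := Hy i; have := Hz i; nra.
split.
  move=> U [n [p [e [x [Pp ->]]]]]; rewrite openE => y; exact: lc_ball_nbhs.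
move=> x U [n [p [e [Pp e0 sub]]]]; exists (lc_ball p e x) => //.
split; first by exists n, p, e, x.
by move=> i; rewrite subrr seminorm0.
Qed.

Lemma seminorm_continuous (p : seminorm E) :
  P p -> continuous (p : lc_space P -> R).
Proof.
move=> Pp x; apply/(@cvgrPdist_lt _ _ _ (nbhs x) (lc_nbhs_filter x)) => e e0.
exists 1%N, (fun=> p), e; split => // y /(_ ord0) /= pyx.
rewrite ltr_norml; apply/andP; split.
  have := seminormD p (y - x) x; rewrite subrK; lra.
by have := seminormD p (x - y) y; rewrite subrK -opprB seminormN; lra.
Qed.

HB.instance Definition _ := PreTopologicalLmod_isTvs.Build R[i] (lc_space P)
  lc_add_continuous lc_scale_continuous lc_locally_convex.
HB.instance Definition _ :=
  PreTopologicalNmodule_isTopologicalNmodule.Build (lc_space P)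
    lc_add_continuous.
HB.instance Definition _ :=
  TopologicalNmodule_isTopologicalLmodule.Build R[i] (lc_space P)
    lc_scale_continuous.
HB.instance Definition _ :=
  Uniform_isTvs.Build R[i] (lc_space P) lc_locally_convex.

End LcSpace.

Section Subspace.
Context {R : realType} {T : Type} (S : submodClosed (T -> R[i]^o)).

Record fsubspace := FSubspace {
  fsub_val :> T -> R[i]^o;
  fsub_valP : fsub_val \in S }.

HB.instance Definition _ := [isSub for fsub_val].
HB.instance Definition _ := [Choice of fsubspace by <:].
HB.instance Definition _ := [SubChoice_isSubLmodule of fsubspace by <:].

End Subspace.

Section Inclusion.
Context {R : realType} {T : Type} {S1 S2 : submodClosed (T -> R[i]^o)}.
Hypothesis S12 : {subset S1 <= S2}.

Definition inclusion (f : fsubspace S1) : fsubspace S2 :=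
  FSubspace (S12 (fsub_valP f)).

End Inclusion.

Section WeightedSpace.
Context {R : realType} {T : Type}.
Implicit Types (H : submodClosed (T -> R[i]^o)) (v : T -> {posnum R}).

Definition weighted_range v (f : T -> R[i]^o) : set R :=
  range (fun x => (v x)%:num * normc (f x)).

Definition weighted_sup v (f : T -> R[i]^o) : R := sup (weighted_range v f).

Definition weighted_pred H (V : set (T -> {posnum R})) : {pred T -> R[i]^o} :=
  [pred f | (f \in H) &&
            `[< forall v, V v -> has_ubound (weighted_range v f) >]].

Lemma has_ubound_weightedD v f g : has_ubound (weighted_range v f) ->
  has_ubound (weighted_range v g) -> has_ubound (weighted_range v (f + g)).
Proof.
move=> [M fM] [N gN]; exists (M + N) => _ [x _ <-].
have := fM _ (ex_intro2 _ _ x I erefl); have := gN _ (ex_intro2 _ _ x I erefl).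
move=> /= ? ?; apply: (@le_trans _ _ ((v x)%:num * normc (f x) +
                                     (v x)%:num * normc (g x))).
  by rewrite -mulrDr ler_wpM2l// le_normcD.
by rewrite lerD.
Qed.

Lemma has_ubound_weightedZ v a f : has_ubound (weighted_range v f) ->
  has_ubound (weighted_range v (a *: f)).
Proof.
move=> [M fM]; exists (normc a * M) => _ [x _ <-].
have /= := fM _ (ex_intro2 _ _ x I erefl) => fx.
rewrite (_ : (a *: f) x = a * f x)// normcM mulrCA ler_wpM2l//.
exact: normc_ge0.
Qed.

Lemma has_ubound_weighted0 v : has_ubound (weighted_range v 0).
Proof. by exists 0 => _ [x _ <-]; rewrite normc0 mulr0. Qed.

Section weighted_pred.
Context (H : submodClosed (T -> R[i]^o)) (V : set (T -> {posnum R})).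

Lemma weighted_submod_closed : submod_closed (weighted_pred H V).
Proof.
split.
  rewrite inE rpred0; apply/asboolP => v _; exact: has_ubound_weighted0.
move=> a f g /andP[Hf /asboolP bf] /andP[Hg /asboolP bg].
rewrite inE rpredD ?rpredZ//=; apply/asboolP => v Vv.
by apply: has_ubound_weightedD; [apply: has_ubound_weightedZ; exact: bf|exact: bg].
Qed.

HB.instance Definition _ :=
  GRing.isSubmodClosed.Build _ _ (weighted_pred H V) weighted_submod_closed.

End weighted_pred.

Section seminorm_of_weight.
Context (H : submodClosed (T -> R[i]^o)) (V : set (T -> {posnum R})).
Context (v : T -> {posnum R}) (Vv : V v).
Implicit Types f g : fsubspace (weighted_pred H V).

Let sup_ub f x : (v x)%:num * normc (f x) <= weighted_sup v f.
Proof.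
apply: ub_le_sup; last by exists x.
by case: f => f /= /andP[_ /asboolP]; exact.
Qed.

Let sup_le f M : 0 <= M -> (forall x, (v x)%:num * normc (f x) <= M) ->
  weighted_sup v f <= M.
Proof.
move=> M0 fM; have [[y fy]|/nonemptyPn f0] := pselect (weighted_range v f !=set0).
  by apply: ge_sup; [exists y|move=> _ [x _ <-]].
by rewrite /weighted_sup f0 sup0.
Qed.

Let sup_ge0 f : 0 <= weighted_sup v f.
Proof.
have [[_ [x _ _]]|/nonemptyPn f0] := pselect (weighted_range v f !=set0).
  by apply: le_trans (sup_ub f x); rewrite mulr_ge0 ?normc_ge0.
by rewrite /weighted_sup f0 sup0.
Qed.

Let supD f g :
  weighted_sup v (f + g : fsubspace _) <= weighted_sup v f + weighted_sup v g.
Proof.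
apply: sup_le => [|x]; first by rewrite addr_ge0.
apply: (@le_trans _ _ ((v x)%:num * (normc (f x) + normc (g x)))).
  by rewrite ler_wpM2l// le_normcD.
by rewrite mulrDr lerD.
Qed.

Let supZ_le (a : R[i]) f :
  weighted_sup v (a *: f : fsubspace _) <= normc a * weighted_sup v f.
Proof.
apply: sup_le => [|x]; first by rewrite mulr_ge0 ?normc_ge0.
rewrite [X in normc X](_ : _ = a * f x)// normcM mulrCA.
by rewrite ler_wpM2l ?normc_ge0.
Qed.

Let supZ (a : R[i]) f :
  weighted_sup v (a *: f : fsubspace _) = normc a * weighted_sup v f.
Proof.
apply/eqP; rewrite eq_le supZ_le/=; have [->|a0] := eqVneq a 0.
  by rewrite normc0 mul0r; exact: sup_ge0 (0 *: f).
have na : 0 < normc a.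
  by rewrite lt_neqAle normc_ge0 andbT eq_sym; apply: contra_neq a0; exact: eq0_normc.
rewrite -ler_pdivlMl// -normcV -[X in weighted_sup v (fsub_val X)](scalerK a0).
exact: supZ_le.
Qed.

Definition weight_seminorm : seminorm (fsubspace (weighted_pred H V)) :=
  @Seminorm R _ (fun f => weighted_sup v f) supD supZ.

End seminorm_of_weight.

(** The functions [f] in [H] with [sup v|f| < oo] for every weight [v] in [V],
    with the topology given by the seminorms [f |-> sup v|f|], [v] in [V]. *)
Definition weighted_space H (V : set (T -> {posnum R})) : tvsType R[i] :=
  lc_space [set p | exists (v : T -> {posnum R}) (Vv : V v),
                      p = weight_seminorm H Vv].

Definition dominated (w : nat -> T -> {posnum R}) : set (T -> {posnum R}) :=
  [set v | forall k, exists C : {posnum R},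
     forall x, (v x)%:num <= C%:num * (w k x)%:num].

End WeightedSpace.

Definition decreasing_weights (R : realType) (T : Type)
    (w : nat -> T -> {posnum R}) : Prop :=
  forall k x, (w k.+1 x)%:num <= (w k x)%:num.

Section InductiveLimit.
Context {R : realType} {T : Type} (H : submodClosed (T -> R[i]^o)).
Context (w : nat -> T -> {posnum R}).

Definition step_pred (k : nat) : {pred T -> R[i]^o} :=
  weighted_pred H [set w k].

Definition weighted_step (k : nat) : tvsType R[i] := weighted_space H [set w k].

(* [dw] is used only in the proof that the union is a vector space. *)
Definition union_pred of decreasing_weights w : {pred T -> R[i]^o} :=
  [pred f | `[< exists k, f \in step_pred k >]].

Context (dw : decreasing_weights w).

Lemma step_pred_mono k l : (k <= l)%N -> {subset step_pred k <= step_pred l}.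
Proof.
move=> /subnK <-; elim: (l - k)%N => [//|m IH] f fk.
have /andP[Hf /asboolP /(_ _ erefl)[M bM]] := IH f fk.
apply/andP; split => //; apply/asboolP => _ ->; exists M => _ [x _ <-].
apply: le_trans (bM _ (ex_intro2 _ _ x I erefl)).
by rewrite ler_wpM2r ?normc_ge0// addSn; exact: dw.
Qed.

Lemma union_submod_closed : submod_closed (union_pred dw).
Proof.
split; first by apply/asboolP; exists 0%N; exact: rpred0.
move=> a f g /asboolP[k fk] /asboolP[l gl]; apply/asboolP; exists (maxn k l).
apply: rpredD; [apply: rpredZ; apply: step_pred_mono fk|apply: step_pred_mono gl].
  exact: leq_maxl.
exact: leq_maxr.
Qed.

HB.instance Definition _ :=
  GRing.isSubmodClosed.Build _ _ (union_pred dw) union_submod_closed.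

Lemma step_union k : {subset step_pred k <= union_pred dw}.
Proof. by move=> f fk; apply/asboolP; exists k. Qed.

(** The union of the spaces [weighted_step k] with the finest locally convex
    topology for which all the inclusions are continuous: it is generated by all
    the seminorms whose restriction to each [weighted_step k] is continuous. *)
Definition weighted_inductive_limit : tvsType R[i] :=
  lc_space [set q : seminorm (fsubspace (union_pred dw)) |
    forall k, continuous ((q \o inclusion (@step_union k)) : weighted_step k -> R)].

Lemma step_continuous k : continuous
  (inclusion (@step_union k) : weighted_step k -> weighted_inductive_limit).
Proof.
move=> f U [n [q [e [Pq e0 sub]]]].
suff : \forall g \near (f : weighted_step k),
    forall i, q i (inclusion (@step_union k) (g - f)) < e.
  apply: filterS => g Hg; apply: sub => i.
  rewrite (_ : _ - _ = inclusion (@step_union k) (g - f)) ?Hg//.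
  exact: val_inj.
apply: (@filter_forall _ _ _ (nbhs (f : weighted_step k))) => i.
have V0 : nbhs (0 : weighted_step k)
    [set h | q i (inclusion (@step_union k) h) < e].
  have /cvgr_lt := Pq i k 0; apply; rewrite /=.
  by rewrite (_ : inclusion _ 0 = 0) ?seminorm0//; exact: val_inj.
by apply: filterS (nbhsT (f : weighted_step k) V0) => _ [h Vh <-];
  rewrite addrC addKr.
Qed.

Lemma inductive_limit_finest (P : set (seminorm (fsubspace (union_pred dw)))) :
  (forall k, continuous
     (inclusion (@step_union k) : weighted_step k -> lc_space P)) ->
  continuous (idfun : weighted_inductive_limit -> lc_space P).
Proof.
move=> cP f U [n [p [e [Pp e0 sub]]]]; exists n, p, e; split => // i k g.
apply: (@continuous_comp (weighted_step k) (lc_space P) R _ (p i)).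
  exact: cP.
exact: seminorm_continuous.
Qed.

Lemma union_sub_weighted (V : set (T -> {posnum R})) : V `<=` dominated w ->
  {subset union_pred dw <= weighted_pred H V}.
Proof.
move=> Vw f /asboolP[k /andP[Hf /asboolP /(_ _ erefl)[M bM]]].
apply/andP; split => //; apply/asboolP => v /Vw /(_ k)[C vC].
exists (C%:num * M) => _ [x _ <-].
apply: (@le_trans _ _ (C%:num * ((w k x)%:num * normc (f x)))).
  by rewrite mulrA ler_wpM2r ?normc_ge0.
by rewrite ler_wpM2l// bM//; exists x.
Qed.

End InductiveLimit.

Section SequenceSpace.
Context {R : realType}.

Definition all_pred : {pred nat -> R[i]^o} := predT.

Lemma all_submod_closed : submod_closed all_pred.
Proof. by []. Qed.

HB.instance Definition _ :=
  GRing.isSubmodClosed.Build _ _ all_pred all_submod_closed.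

Definition K_infty (lam : nat -> nat -> {posnum R}) : tvsType R[i] :=
  weighted_space all_pred (dominated lam).

End SequenceSpace.

Section Holomorphic.
Context {R : realType} (G : set R[i]^o).

(* Complex differentiability of the extension by [0]; at a point of an open set
   [G] the extension plays no role. *)
Definition holomorphic_pred : {pred G -> R[i]^o} :=
  [pred f : G -> R[i]^o | `[< forall z : G,
     derivable (valL_ (0 : R[i]^o) f) (\val z : R[i]^o) 1 >]].

Lemma holomorphic_submod_closed : submod_closed holomorphic_pred.
Proof.
split.
  apply/asboolP => z; rewrite (_ : valL_ _ _ = cst 0); first exact: derivable_cst.
  by apply/funext => x; rewrite /valL_ /=; case: ('oinv_set_val x).
move=> a f g /asboolP hf /asboolP hg; apply/asboolP => z.
rewrite (_ : valL_ _ _ = a *: valL_ (0 : R[i]^o) f + valL_ (0 : R[i]^o) g).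
  by apply: derivableD; [apply: derivableZ; exact: hf|exact: hg].
apply/funext => x; rewrite /valL_ /= !fctE; case: ('oinv_set_val x) => //=.
by rewrite scaler0 addr0.
Qed.

HB.instance Definition _ :=
  GRing.isSubmodClosed.Build _ _ holomorphic_pred holomorphic_submod_closed.

End Holomorphic.
Arguments holomorphic_pred {R} G.

Section HalfAnnulus.
Context {R : realType}.

(* The principal argument, in ]-pi, pi], of a nonzero complex number. *)
Definition carg (z : R[i]) : R :=
  if 0 <= complex.Im z then acos (complex.Re z / normc z)
  else - acos (complex.Re z / normc z).

Lemma carg_polar (r t : R) : 0 < r -> 0 <= t <= pi ->
  carg (r * cos t +i* (r * sin t)) = t.
Proof.
move=> r0 /andP[t0 tpi]; rewrite /carg /= !exprMn -mulrDr cos2Dsin2 mulr1.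
have s0 : 0 <= sin t by apply: sin_ge0_pi; rewrite t0.
rewrite mulr_ge0 ?(ltW r0)//.
rewrite sqrtr_sqr gtr0_norm//.
by rewrite mulrAC divff ?gt_eqF// mul1r cosK// in_itv/= t0.
Qed.

Definition G1 : set R[i]^o :=
  [set z : R[i] | 1 / 2 < normc z < 1 /\ 0 < carg z < pi].

(* Sequences are indexed from [0]: the index [n] below stands for [n + 1]. *)
Definition theta (n : nat) : R := 1 / (2 * n.+1%:R).
Definition radius (n : nat) : R := 1 / (2 ^+ 5 * n.+1%:R ^+ 2).
Definition peak (n : nat) : R := theta n + 1 / (2 ^+ 4 * n.+1%:R ^+ 2).

Definition affine_on (f : R -> R) (a b : R) : Prop :=
  exists c d : R, forall t, a <= t <= b -> f t = c * t + d.

(* Only the values of [hat k] on [0, pi] are constrained. *)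
Record angular_profile (lam : nat -> nat -> {posnum R})
    (hat : nat -> R -> {posnum R}) : Prop := AngularProfile {
  hat_plateau : forall k n t, theta n - radius n <= t <= theta n + radius n ->
    (hat k t)%:num = (lam k n)%:num;
  hat_peak : forall k n, (hat k (peak n))%:num = 1;
  hat_0 : forall k, (hat k 0)%:num = 1;
  hat_pi : forall k, (hat k pi)%:num = 1;
  hat_affine_left : forall k n,
    affine_on (fun t => (hat k t)%:num) (theta n + radius n) (peak n);
  hat_affine_right : forall k n,
    affine_on (fun t => (hat k t)%:num) (peak n.+1) (theta n - radius n);
  hat_affine_last : forall k,
    affine_on (fun t => (hat k t)%:num) (peak 0) pi }.

Definition angular_weights (hat : nat -> R -> {posnum R}) :
    nat -> G1 -> {posnum R} :=
  fun k z => hat k (carg (\val z)).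

Lemma affine_on_le (f g : R -> R) a b : affine_on f a b -> affine_on g a b ->
  f a <= g a -> f b <= g b -> forall t, a <= t <= b -> f t <= g t.
Proof.
move=> [c [d fE]] [c' [d' gE]] fga fgb t tab.
have ab : a <= b by case/andP: tab; exact: le_trans.
move: fga fgb; rewrite !fE ?gE ?lexx ?ab// => fga fgb.
by case/andP: tab => at_ tb; have [cc|cc] := leP c c'; nra.
Qed.

Lemma peak_cover (t : R) : 0 < t -> t < peak 0 ->
  exists n, peak n.+1 <= t <= peak n.
Proof.
move=> t0 tp.
have ex : exists n, peak n <= t.
  exists (Num.truncn t^-1); rewrite /peak /theta.
  have := truncnS_gt t^-1; set N := _.+1%:R => tN.
  have N0 : 0 < N by rewrite ltr0n.
  have u1 : N^-1 <= 1 by rewrite invf_le1// ler1n.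
  have u0 : 0 < N^-1 by rewrite invr_gt0.
  have ut : N^-1 < t by rewrite -[t]invrK ltf_pV2// posrE invr_gt0.
  have -> : 1 / (2 * N) = N^-1 / 2 by field; rewrite gt_eqF.
  have -> : 1 / (2 ^+ 4 * N ^+ 2) = N^-1 ^+ 2 / 16 by field; rewrite gt_eqF.
  have u2 : N^-1 ^+ 2 <= N^-1 by rewrite expr2 ler_piMl// ltW.
  suff aux (u v s : R) : 0 < u -> u < s -> v <= u -> u / 2 + v / 16 <= s.
    exact: aux.
  by move=> *; lra.
case: (ex_minnP ex) => -[|n] pn min_n; first by move: pn; rewrite leNgt tp.
exists n; rewrite pn/= leNgt; apply/negP => /ltW /min_n.
by rewrite ltnn.
Qed.

Lemma angular_weights_decreasing lam hat : decreasing_weights lam ->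
  angular_profile lam hat -> decreasing_weights (angular_weights hat).
Proof.
move=> dlam ph k [z zG]; rewrite /angular_weights /=.
have [_ /andP[]] := set_mem zG; move: (carg z) => t t0 tpi {z zG}.
have rad0 n : 0 <= radius n by rewrite divr_ge0// mulr_ge0// exprn_ge0.
have [tp|pt] := ltP t (peak 0).
  have [n /andP[pnt tpn]] := peak_cover t0 tp.
  have [t1|t1] := leP t (theta n - radius n).
    apply: (affine_on_le (hat_affine_right ph k.+1 n)
                         (hat_affine_right ph k n)); rewrite ?pnt//.
      by rewrite !(hat_peak ph).
    by rewrite !(@hat_plateau _ _ ph _ n) ?dlam//; have := rad0 n; lra.
  have [t2|t2] := leP t (theta n + radius n).
    by rewrite !(@hat_plateau _ _ ph _ n) ?dlam// (ltW t1).
  apply: (affine_on_le (hat_affine_left ph k.+1 n)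
                       (hat_affine_left ph k n)); rewrite ?tpn ?(ltW t2)//.
    by rewrite !(@hat_plateau _ _ ph _ n) ?dlam//; have := rad0 n; lra.
  by rewrite !(hat_peak ph).
apply: (affine_on_le (hat_affine_last ph k.+1) (hat_affine_last ph k)).
- by rewrite !(hat_peak ph).
- by rewrite !(hat_pi ph).
- by rewrite pt ltW.
Qed.

End HalfAnnulus.

Section WeightedHolomorphic.
Context {R : realType} (w : nat -> @G1 R -> {posnum R}).

Definition W_bar : set (@G1 R -> {posnum R}) :=
  dominated w `&` [set v | continuous (fun z => (v z)%:num : R)].

Definition HW_bar : tvsType R[i] := weighted_space (holomorphic_pred G1) W_bar.

Context (dw : decreasing_weights w).

Definition WH : tvsType R[i] :=
  weighted_inductive_limit (holomorphic_pred G1) dw.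

Lemma W_bar_dominated : W_bar `<=` dominated w.
Proof. by move=> v []. Qed.

Definition WH_to_HW_bar : WH -> HW_bar :=
  inclusion (@union_sub_weighted _ _ (holomorphic_pred G1) _ dw _ W_bar_dominated).

(* [WH] and [HW_bar] consist of the same functions; they coincide topologically
   when the open sets of [WH] are those of [HW_bar]. Pulling back along the
   inclusion avoids relying on the surjectivity of [WH_to_HW_bar]. *)
Definition coincide_topologically : Prop :=
  @open WH = [set WH_to_HW_bar @^-1` U | U in @open HW_bar].

End WeightedHolomorphic.

(* Main.v *)
(** The kernel [kernel n z = 2 eps_n u_n / ((1 + eps_n) u_n - z)], with
    [u_n = exp (i theta_n)], is bounded by 2 on [G1] and equals 1 at the node
    [(1 - eps_n) u_n]. Off the sector [I_n] the distance from [z] to the pole is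
    bounded below independently of [eps_n], so for [eps_n] small the kernel is
    there as small as we like compared with [1 / n^2]. As every weight in
    [W_bar] is comparable on the sectors to a weight in the dominated sequences,
    and these can be taken [>= 1 / n^2], the synthesis [x |-> sum_n x_n kernel_n]
    is continuous from [K_infty] to [HW_bar]. Sampling at the nodes is continuous
    in the other direction, and sampling after synthesis is the identity plus an
    operator of norm [<= 1/4] from the [1 / n^2]-weighted sup space to the bounded
    sequences, hence invertible by a Neumann series. This gives a continuous left
    inverse of the synthesis, i.e. a complemented copy of [K_infty].

    If [WH] and [HW_bar] had the same open sets, [K_infty] would be bornological:
    for an absolutely convex [D] absorbing the bounded sets, the gauge of [D]
    composed with the left inverse is continuous on every step, so its unit ball
    is the trace on [WH] of an open set of [HW_bar]; its preimage under the
    synthesis, which takes values in [WH] because [K_infty] is the union of its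
    steps, is a neighbourhood of 0 inside [D]. *)
From HB Require Import structures.
Require Import Defs.
From mathcomp Require Import all_boot all_order all_algebra.
From mathcomp Require Import all_classical all_reals all_analysis.
From mathcomp Require Import complex.
From mathcomp Require Import ring lra.

Set Implicit Arguments.
Unset Strict Implicit.
Unset Printing Implicit Defensive.

Import Order.TTheory GRing.Theory Num.Theory.
Import numFieldNormedType.Exports.
Import Normc.

Local Open Scope classical_set_scope.
Local Open Scope ring_scope.
Local Open Scope complex_scope.

(** * Geometrically dominated complex series *)

Section GeometricSums.
Context {R : realType}.
Implicit Types (u v : nat -> R[i]) (s t : R[i]).

Lemma normc_of_norm (z : R[i]) : `|z| = (normc z)%:C.
Proof. by []. Qed.

Lemma normc_real (r : R) : normc r%:C = `|r|.
Proof. by rewrite /= expr0n /= addr0 sqrtr_sqr. Qed.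

Lemma realcM (a b : R) : (a * b)%:C = a%:C * b%:C.
Proof. by rewrite rmorphM. Qed.

Lemma ler_Re_normc (z : R[i]) : `|complex.Re z| <= normc z.
Proof.
by case: z => a b /=; rewrite -sqrtr_sqr ler_wsqrtr// lerDl sqr_ge0.
Qed.

Lemma ler_Im_normc (z : R[i]) : `|complex.Im z| <= normc z.
Proof.
by case: z => a b /=; rewrite -sqrtr_sqr ler_wsqrtr// lerDr sqr_ge0.
Qed.

Lemma normc_le_ReIm (z : R[i]) :
  normc z <= `|complex.Re z| + `|complex.Im z|.
Proof.
case: z => a b; rewrite [X in normc X](_ : _ = a%:C + 'i * b%:C).
  apply: (le_trans (le_normcD _ _)); rewrite normcM !normc_real/=.
  by rewrite expr0n/= add0r expr1n sqrtr1 mul1r.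
by rewrite [LHS]complexE.
Qed.

Lemma normcB (z t : R[i]) : normc (z - t) = normc (t - z).
Proof. by rewrite -normcN opprB. Qed.

Lemma normc_sum (I : Type) (r : seq I) (P : pred I) (F : I -> R[i]) :
  normc (\sum_(i <- r | P i) F i) <= \sum_(i <- r | P i) normc (F i).
Proof.
elim/big_ind2 : _ => [|x y x' y' h h'|//]; first by rewrite normc0.
by apply: (le_trans (le_normcD _ _)); exact: lerD.
Qed.

(** Stands in for passing to the limit: later identities are proved by bounding the norm of a
    difference by a geometric sequence. *)
Lemma ler0_geometric (x M : R) : (forall n, x <= M / 2 ^+ n) -> x <= 0.
Proof.
move=> h; rewrite leNgt; apply/negP => x0.
have M0 : 0 < M by have := h 0%N; rewrite expr0 divr1; exact: lt_le_trans.
pose n := Num.truncn (M / x).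
have := h n; rewrite leNgt => /negP; apply.
rewrite ltr_pdivrMr ?exprn_gt0// mulrC -ltr_pdivrMr//.
apply: (lt_le_trans (truncnS_gt _)); rewrite -natrX ler_nat -/n.
exact: ltn_expl.
Qed.

Lemma sum_geometric (M : R) N : \sum_(n < N) M / 2 ^+ n = 2 * M - 2 * M / 2 ^+ N.
Proof.
elim: N => [|N IH]; first by rewrite big_ord0 expr0; lra.
by rewrite big_ord_recr/= IH exprS; field; rewrite expf_neq0//; lra.
Qed.

Lemma sum_geometric_le (M : R) N : 0 <= M -> \sum_(n < N) M / 2 ^+ n <= 2 * M.
Proof.
by move=> M0; rewrite sum_geometric gerBl divr_ge0 ?mulr_ge0 ?exprn_ge0.
Qed.

(** Keeping the exact remainder [2 * M / 2 ^+ (N + k)] on the right is what lets the induction on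
    [k] close. *)
Lemma geometric_tail (u : nat -> R) (M : R) N k :
  (forall n, `|u n| <= M / 2 ^+ n) ->
  `|\sum_(n < N + k) u n - \sum_(n < N) u n| <= 2 * M / 2 ^+ N - 2 * M / 2 ^+ (N + k).
Proof.
move=> uM; elim: k => [|k IH]; first by rewrite addn0 !subrr normr0.
rewrite addnS big_ord_recr /= addrAC.
apply: (le_trans (ler_normD _ _)); apply: (le_trans (lerD IH (uM _))).
rewrite exprS le_eqVlt; apply/orP; left; apply/eqP; field.
by rewrite ?expf_neq0//; lra.
Qed.

Lemma real_geometric_sum (u : nat -> R) (M : R) :
  (forall n, `|u n| <= M / 2 ^+ n) ->
  exists s : R, forall N, `|s - \sum_(n < N) u n| <= 2 * M / 2 ^+ N.
Proof.
move=> uM; pose S N := \sum_(n < N) u n.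
have M0 : 0 <= M by have := uM 0%N; rewrite expr0 divr1; exact: le_trans.
have SNk N k : `|S (N + k)%N - S N| <= 2 * M / 2 ^+ N.
  apply: (le_trans (geometric_tail _ _ uM)).
  by rewrite gerBl divr_ge0 ?mulr_ge0 ?exprn_ge0.
have cS : cvgn S.
  rewrite (_ : S = series u); last first.
    by apply/funext => N; rewrite /series /= big_mkord.
  apply: normed_cvg; apply: (@series_le_cvg _ _ (geometric M 2^-1)) => [n|n|n|].
  - exact: normr_ge0.
  - by rewrite /geometric /= mulr_ge0 ?exprn_ge0// invr_ge0.
  - by rewrite /geometric /= exprVn.
  - by apply: is_cvg_geometric_series; rewrite ger0_norm; lra.
exists (limn S) => N.
rewrite -/(S N); have cN : (fun k => `|S k - S N|) @ \oo --> `|limn S - S N|.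
  by apply: cvg_norm; apply: cvgB; [exact: cS|exact: cvg_cst].
rewrite -(cvg_lim (@Rhausdorff R) cN); apply: limr_le; first exact: cvgP cN.
by near=> k; have /subnKC <- : (N <= k)%N by near: k; exact: nbhs_infty_ge.
Unshelve. all: by end_near. Qed.

(** Summation is encoded by a geometric rate of convergence of the partial sums, with an unspecified
    constant. This is stable under linear combinations and determines the sum, so no limits in
    [R[i]] have to be handled. *)
Definition is_csum u s : Prop :=
  exists M : R, forall N, normc (s - \sum_(n < N) u n) <= M / 2 ^+ N.

Lemma ReD (x y : R[i]) : complex.Re (x + y) = complex.Re x + complex.Re y.
Proof. by case: x; case: y. Qed.

Lemma ImD (x y : R[i]) : complex.Im (x + y) = complex.Im x + complex.Im y.
Proof. by case: x; case: y. Qed.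

(** Real and imaginary parts are summed separately, each with error [2 * M / 2 ^+ N]; hence the
    factor 4. *)
Lemma csum_exists u (M : R) : (forall n, normc (u n) <= M / 2 ^+ n) ->
  exists s, forall N, normc (s - \sum_(n < N) u n) <= 4 * M / 2 ^+ N.
Proof.
move=> uM.
have [|s1 h1] := @real_geometric_sum (fun n => complex.Re (u n)) M.
  by move=> n; exact: le_trans (ler_Re_normc _) (uM n).
have [|s2 h2] := @real_geometric_sum (fun n => complex.Im (u n)) M.
  by move=> n; exact: le_trans (ler_Im_normc _) (uM n).
exists (s1 +i* s2) => N.
have sR : complex.Re (\sum_(n < N) u n) = \sum_(n < N) complex.Re (u n).
  by apply: (big_morph _ ReD).
have sI : complex.Im (\sum_(n < N) u n) = \sum_(n < N) complex.Im (u n).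
  by apply: (big_morph _ ImD).
apply: (le_trans (normc_le_ReIm _)).
have := lerD (h1 N) (h2 N); rewrite -sR -sI.
case: (\sum_(n < N) u n) => a b /= /le_trans; apply.
by rewrite -mulrDl; apply: ler_wpM2r; [rewrite invr_ge0 exprn_ge0|lra].
Qed.

Lemma is_csum_le u s (B : R) : is_csum u s ->
  (forall N, normc (\sum_(n < N) u n) <= B) -> normc s <= B.
Proof.
move=> [M sM] uB; rewrite -subr_le0; apply: (@ler0_geometric _ M) => N.
have := le_normcD (s - \sum_(n < N) u n) (\sum_(n < N) u n).
by rewrite subrK; have := sM N; have := uB N; lra.
Qed.

Lemma is_csumZD a u v s t : is_csum u s -> is_csum v t ->
  is_csum (fun n => a * u n + v n) (a * s + t).
Proof.
move=> [M sM] [M' tM]; exists (normc a * M + M') => N.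
rewrite big_split /= -mulr_sumr opprD addrACA -mulrBr mulrDl.
apply: (le_trans (le_normcD _ _)); rewrite normcM -mulrA.
by apply: lerD; [apply: ler_wpM2l; [exact: normc_ge0|exact: sM]|exact: tM].
Qed.

Lemma is_csum_unique u s t : is_csum u s -> is_csum u t -> s = t.
Proof.
move=> us ut; apply/eqP; rewrite -subr_eq0; apply/eqP; apply: eq0_normc.
apply/eqP; rewrite eq_le normc_ge0 andbT.
have := is_csumZD (-1) ut us; rewrite mulN1r addrC => h.
apply: (is_csum_le h) => N; rewrite big1 ?normc0// => n _.
by rewrite mulN1r addNr.
Qed.

Definition csum u : R[i] := xget 0 [set s | is_csum u s].

Lemma csumP u s : is_csum u s -> csum u = s.
Proof.
by move=> us; apply: (is_csum_unique _ us); rewrite /csum; case: xgetP => [//|/(_ s)].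
Qed.

Lemma csum_tail u (M : R) N : (forall n, normc (u n) <= M / 2 ^+ n) ->
  normc (csum u - \sum_(n < N) u n) <= 4 * M / 2 ^+ N.
Proof.
by move=> /csum_exists[s us]; rewrite (@csumP u s) //; exists (4 * M).
Qed.

Lemma csum_is u (M : R) : (forall n, normc (u n) <= M / 2 ^+ n) ->
  is_csum u (csum u).
Proof. by move=> uM; exists (4 * M) => N; exact: csum_tail. Qed.

(** Used to subtract the diagonal term from a synthesis series. The factor [2 ^+ m] pays for the
    partial sums that stop before the index [m]. *)
Lemma is_csum_delta m s : is_csum (fun n => if n == m then s else 0) s.
Proof.
exists (normc s * 2 ^+ m) => N; have [mN|Nm] := ltnP m N.
  rewrite (bigD1 (Ordinal mN)) //= eqxx big1 ?addr0 ?subrr ?normc0.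
    by rewrite !mulr_ge0 ?normc_ge0 ?invr_ge0 ?exprn_ge0.
  by move=> n; rewrite -val_eqE /= => /negPf ->.
rewrite big1 => [|n _]; last by rewrite ltn_eqF// (leq_trans (ltn_ord n)).
rewrite subr0 -mulrA ler_peMr ?normc_ge0// ler_pdivlMr ?exprn_gt0// mul1r.
by rewrite ler_weXn2l// ler1n.
Qed.

End GeometricSums.

(** * Locally convex spaces and gauges *)

Section LocallyConvexCriteria.
Context {R : realType} {E F : lmodType R[i]}.
Implicit Types (P : set (seminorm E)) (Q : set (seminorm F)).

Lemma lc_continuous P Q (L : E -> F) :
  (forall x y, L (x - y) = L x - L y) ->
  (forall q, Q q -> exists p (C : R), P p /\ forall x, q (L x) <= C * p x) ->
  continuous (L : lc_space P -> lc_space Q).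
Proof.
move=> LB LQ x U [n [q [e [Qq e0 sub]]]].
have /choice[p Hp] : forall i : 'I_n, exists pC : seminorm E * R,
    P pC.1 /\ forall x, q i (L x) <= pC.2 * pC.1 x.
  by move=> i; have [p [C h]] := LQ _ (Qq i); exists (p, C).
(* The constants may have any sign, so [|C| + 1] serves as a positive upper bound. *)
pose d := \big[Num.min/1]_i (e / (`|(p i).2| + 1)).
have C0 i : 0 < `|(p i).2| + 1 by rewrite ltr_wpDl.
have d0 : 0 < d by apply: lt_bigmin => // i _; rewrite divr_gt0.
exists n, (fun i => (p i).1), d; split => // [i|y Hy]; first by have [] := Hp i.
apply: sub => i; rewrite -LB; apply: (le_lt_trans ((Hp i).2 _)).
have pd : (p i).1 (y - x) < e / (`|(p i).2| + 1).
  by apply: (lt_le_trans (Hy i)); exact: bigmin_le_cond.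
have p0 := seminorm_ge0 (p i).1 (y - x).
apply: (@le_lt_trans _ _ ((`|(p i).2| + 1) * (p i).1 (y - x))).
  by apply: ler_wpM2r => //; apply: (le_trans (ler_norm _)); rewrite lerDl.
by rewrite mulrC -ltr_pdivlMr.
Qed.

Lemma lc_continuous_real P (h : E -> R) p (C : R) : P p ->
  (forall x y, `|h x - h y| <= C * p (x - y)) ->
  continuous (h : lc_space P -> R).
Proof.
move=> Pp hC x; apply/(@cvgrPdist_lt _ _ _ (nbhs x) (lc_nbhs_filter x)) => e e0.
have C0 : 0 < `|C| + 1 by rewrite ltr_wpDl.
exists 1%N, (fun=> p), (e / (`|C| + 1)); split => //; first by rewrite divr_gt0.
move=> y /(_ ord0) /= yx; rewrite distrC; apply: (le_lt_trans (hC _ _)).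
have p0 := seminorm_ge0 p (y - x).
apply: (@le_lt_trans _ _ ((`|C| + 1) * p (y - x))).
  by apply: ler_wpM2r => //; apply: (le_trans (ler_norm _)); rewrite lerDl.
by rewrite mulrC -ltr_pdivlMr.
Qed.

(** For [|a| >= (m + 1) / e] every chosen seminorm of [a^-1 *: x] is at most [m / |a| < e]; the
    [+ 1] gives the strict inequality. *)
Lemma lc_bounded P (B : set (lc_space P)) :
  (forall p, P p -> exists M : R, forall x, B x -> p x <= M) ->
  von_neumann_bounded B.
Proof.
move=> BM U [n [p [e [Pp e0 sub]]]].
have /choice[M HM] : forall i : 'I_n, exists M : R, forall x, B x -> p i x <= M.
  by move=> i; exact: BM.
pose m := \big[Num.max/1]_i M i.
have m1 : 1 <= m by exact: bigmax_ge_id.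
have m0 : 0 < (m + 1) / e by rewrite divr_gt0//; lra.
exists ((m + 1) / e)%:C; first by rewrite ltcR.
move=> a; rewrite normc_of_norm lecR => ra x Bx.
have na : 0 < normc a by exact: lt_le_trans ra.
have a0 : a != 0 by apply: contraTneq na => ->; rewrite normc0 ltxx.
exists (a^-1 *: x); last by rewrite scalerA divff// scale1r.
apply: sub => i; rewrite subr0 seminormZ normcV mulrC ltr_pdivrMr//.
move: ra; rewrite ler_pdivrMr// mulrC; apply: lt_le_trans.
apply: (le_lt_trans (HM i _ Bx)); rewrite ltr_pwDr//.
exact: le_bigmax.
Qed.

End LocallyConvexCriteria.

(** * Minkowski functionals of absolutely convex absorbing sets *)

Section Gauge.
Context {R : realType} {E : lmodType R[i]} (D : set E).
Hypothesis D_convex : forall (a b : R[i]) (x y : E), normc a + normc b <= 1 ->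
  D x -> D y -> D (a *: x + b *: y).
Hypothesis D_absorbing : forall x, exists2 t : R, 0 < t & D ((t^-1)%:C *: x).

(** The Minkowski functional of [D]. By [D_absorbing] the infimum is taken over a nonempty set. *)
Definition gauge (x : E) : R := inf [set t : R | 0 < t /\ D ((t^-1)%:C *: x)].

Let D_balanced (a : R[i]) x : normc a <= 1 -> D x -> D (a *: x).
Proof.
move=> a1 Dx; have := @D_convex a 0 x x; rewrite normc0 addr0 scale0r addr0.
exact.
Qed.

Lemma gauge_le (t : R) x : 0 < t -> D ((t^-1)%:C *: x) -> gauge x <= t.
Proof. by move=> t0 Dx; apply: ge_inf => //; exists 0 => s [/ltW]. Qed.

Lemma le_gauge (m : R) x :
  (forall t : R, 0 < t -> D ((t^-1)%:C *: x) -> m <= t) -> m <= gauge x.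
Proof.
move=> h; apply: lb_le_inf => [|t [t0 Dx]]; last exact: h.
by have [t t0 Dx] := D_absorbing x; exists t.
Qed.

Lemma gauge_ge0 x : 0 <= gauge x.
Proof. by apply: le_gauge => t /ltW. Qed.

Lemma gauge_lt (t : R) x : gauge x < t -> D ((t^-1)%:C *: x).
Proof.
move=> xt; have t0 : 0 < t := le_lt_trans (gauge_ge0 x) xt.
have [s [s0 Ds] st] : exists2 s : R, 0 < s /\ D ((s^-1)%:C *: x) & s < t.
  by apply: contrapT => h; move: xt; rewrite ltNge => /negP; apply;
    apply: le_gauge => s s0 Ds; rewrite leNgt; apply/negP => st; apply: h; exists s.
rewrite (_ : (t^-1)%:C = (s / t)%:C * (s^-1)%:C); last first.
  by rewrite -realcM mulrAC divff ?mul1r// gt_eqF.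
rewrite -scalerA; apply: D_balanced => //.
by rewrite normc_real gtr0_norm ?divr_gt0// ler_pdivrMr// mul1r ltW.
Qed.

Lemma gaugeD x y : gauge (x + y) <= gauge x + gauge y.
Proof.
apply/ler_addgt0Pl => e e0; pose s := gauge x + e / 2; pose t := gauge y + e / 2.
have s0 : 0 < s by rewrite ltr_wpDl ?gauge_ge0// divr_gt0.
have t0 : 0 < t by rewrite ltr_wpDl ?gauge_ge0// divr_gt0.
have st0 : 0 < s + t by rewrite addr_gt0.
rewrite (_ : e + _ = s + t); last by rewrite /s /t; lra.
apply: gauge_le => //.
have Dx : D ((s^-1)%:C *: x) by apply: gauge_lt; rewrite /s ltrDl divr_gt0.
have Dy : D ((t^-1)%:C *: y) by apply: gauge_lt; rewrite /t ltrDl divr_gt0.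
(* [(x + y) / (s + t)] is the convex combination of [x / s] and [y / t] with weights [s / (s + t)]
   and [t / (s + t)]. *)
have := @D_convex (s / (s + t))%:C (t / (s + t))%:C _ _ _ Dx Dy.
rewrite !scalerA -!realcM !normc_real !gtr0_norm ?divr_gt0//.
rewrite -mulrDl divff ?gt_eqF// => /(_ (lexx _)).
rewrite (_ : s / (s + t) / s = (s + t)^-1); last first.
  by rewrite mulrAC divff ?mul1r// gt_eqF.
rewrite (_ : t / (s + t) / t = (s + t)^-1); last first.
  by rewrite mulrAC divff ?mul1r// gt_eqF.
by rewrite -scalerDr.
Qed.

Let gaugeZ_le (a : R[i]) x : gauge (a *: x) <= normc a * gauge x.
Proof.
have [->|a0] := eqVneq a 0.
  rewrite normc0 mul0r scale0r; apply/ler_addgt0Pl => e e0; rewrite addr0.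
  apply: gauge_le => //; rewrite scaler0.
  have [t _ Dx] := D_absorbing 0; by rewrite scaler0 in Dx.
have na : 0 < normc a.
  by rewrite lt_neqAle normc_ge0 andbT eq_sym; apply: contra_neq a0; exact: eq0_normc.
rewrite -ler_pdivrMl//; apply: le_gauge => t t0 Dx; rewrite ler_pdivrMl//.
apply: gauge_le; first by rewrite mulr_gt0.
rewrite scalerA (_ : _ * a = (a * ((normc a)^-1)%:C) * (t^-1)%:C).
  rewrite -scalerA; apply: D_balanced => //.
  by rewrite normcM normc_real gtr0_norm ?invr_gt0// divff ?gt_eqF.
by rewrite invfM realcM mulrC mulrA.
Qed.

Lemma gaugeZ (a : R[i]) x : gauge (a *: x) = normc a * gauge x.
Proof.
apply/eqP; rewrite eq_le gaugeZ_le/=; have [->|a0] := eqVneq a 0.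
  by rewrite normc0 mul0r gauge_ge0.
have na : 0 < normc a.
  by rewrite lt_neqAle normc_ge0 andbT eq_sym; apply: contra_neq a0; exact: eq0_normc.
(* The reverse inequality is [gaugeZ_le] for the scalar [a^-1] and the vector [a *: x]. *)
rewrite -ler_pdivlMl// -normcV -[X in gauge X](scalerK a0).
exact: gaugeZ_le.
Qed.

Definition gauge_seminorm : seminorm E := Seminorm gaugeD gaugeZ.

Lemma gauge_lt1 x : gauge x < 1 -> D x.
Proof. by move=> /gauge_lt; rewrite invr1 scale1r. Qed.

End Gauge.

(** * Bounds for weighted suprema *)

Section WeightedSup.
Context {R : realType} {T : Type}.
Implicit Types (v : T -> {posnum R}) (f : T -> R[i]^o).

Lemma weighted_sup_ub v f x : has_ubound (weighted_range v f) ->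
  (v x)%:num * normc (f x) <= weighted_sup v f.
Proof. by move=> fM; apply: ub_le_sup => //; exists x. Qed.

Lemma weighted_sup_le v f (M : R) : 0 <= M ->
  (forall x, (v x)%:num * normc (f x) <= M) -> weighted_sup v f <= M.
Proof.
move=> M0 fM; have [[y fy]|/nonemptyPn f0] := pselect (weighted_range v f !=set0).
  by apply: ge_sup; [exists y|move=> _ [x _ <-]].
by rewrite /weighted_sup f0 sup0.
Qed.

Lemma weighted_space_bounded (H : submodClosed (T -> R[i]^o)) V v
    (f : fsubspace (weighted_pred H V)) :
  V v -> has_ubound (weighted_range v f).
Proof. by case: f => f /= /andP[_ /asboolP]; exact. Qed.

End WeightedSup.

(** * The half annulus *)

Section Plane.
Context {R : realType}.
Implicit Types (z : R[i]).

Lemma normc_sqr z : normc z ^+ 2 = complex.Re z ^+ 2 + complex.Im z ^+ 2.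
Proof. by case: z => a b /=; rewrite sqr_sqrtr// addr_ge0 ?sqr_ge0. Qed.

Lemma lipschitz1_continuous (h : R[i]^o -> R) :
  (forall x y, `|h x - h y| <= normc (x - y)) -> continuous h.
Proof.
move=> hL x; apply/(@cvgrPdist_lt _ _ _ (nbhs x) (nbhs_filter x)) => e e0.
apply/nbhs_ballP; exists (e%:C : R[i]); first by rewrite /= ltcR.
by move=> y; rewrite /ball /= normc_of_norm ltcR; exact: le_lt_trans.
Qed.

Lemma continuous_Re : continuous (@complex.Re R : R[i]^o -> R).
Proof.
apply: lipschitz1_continuous => x y; apply: le_trans (ler_Re_normc _).
by case: x; case: y.
Qed.

Lemma continuous_Im : continuous (@complex.Im R : R[i]^o -> R).
Proof.
apply: lipschitz1_continuous => x y; apply: le_trans (ler_Im_normc _).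
by case: x; case: y.
Qed.

Lemma ler_normcB (x y : R[i]) : normc x - normc y <= normc (x - y).
Proof. by have := le_normcD (x - y) y; rewrite subrK; lra. Qed.

Lemma continuous_normc : continuous (@normc R : R[i]^o -> R).
Proof.
apply: lipschitz1_continuous => x y; rewrite ler_norml ler_normcB andbT.
by rewrite lerNl opprB normcB ler_normcB.
Qed.

Lemma Re_div_normc_itv z : 0 < complex.Im z -> -1 < complex.Re z / normc z < 1.
Proof.
move=> z0; have := normc_sqr z; have := normc_ge0 z.
move: (complex.Re z) (complex.Im z) (normc z) z0 => a b r b0 r0 rE.
have rp : 0 < r by rewrite lt_neqAle r0 andbT; apply/eqP => rr; subst r; nra.
by rewrite ltr_pdivlMr// ltr_pdivrMr//; apply/andP; split; nra.
Qed.

Lemma carg_upper z : 0 < complex.Im z -> carg z = acos (complex.Re z / normc z).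
Proof. by move=> /ltW z0; rewrite /carg z0. Qed.

(** Below the real axis [carg] is [<= 0]; on the axis the quotient is 1 or -1, which gives 0 or
    [pi]. Through this, [G1] is described by inequalities on the norm and the imaginary part, which
    are visibly open. *)
Lemma carg_itv z : z != 0 -> (0 < carg z < pi) = (0 < complex.Im z).
Proof.
move=> z0; apply/idP/idP => [|iz]; last first.
  rewrite carg_upper//; have /andP[l u] := Re_div_normc_itv iz.
  by rewrite acos_gt0 ?acos_ltpi// ?(ltW l) ?(ltW u) ?l ?u.
have n0 : 0 < normc z.
  by rewrite lt_neqAle normc_ge0 andbT eq_sym; apply: contra_neq z0; exact: eq0_normc.
have l1 : `|complex.Re z / normc z| <= 1.
  by rewrite normrM normfV (gtr0_norm n0) ler_pdivrMr// mul1r ler_Re_normc.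
rewrite /carg; case: (ltgtP 0 (complex.Im z)) => // im0 /andP[].
  by rewrite oppr_gt0 ltNge acos_ge0// -ler_norml.
have : normc z ^+ 2 = complex.Re z ^+ 2 by rewrite normc_sqr -im0 expr0n addr0.
move=> /eqP; rewrite eqf_sqr => /orP[/eqP <-|/eqP nz].
  by rewrite divff ?gt_eqF// acos1 ltxx.
rewrite (_ : complex.Re z / normc z = -1) ?acosN1 ?ltxx//.
by rewrite nz invrN mulrN divff// -oppr_eq0 -nz gt_eqF.
Qed.

Lemma G1P z : G1 z <-> 1 / 2 < normc z < 1 /\ 0 < complex.Im z.
Proof.
rewrite /G1 /=; split=> -[n12 h]; split=> //; move: h; rewrite carg_itv//;
  by apply: contraTneq n12 => ->; rewrite normc0 lt_neqAle; apply/negP => /andP[]; lra.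
Qed.

Lemma polar_form z : G1 z ->
  z = (normc z * cos (carg z)) +i* (normc z * sin (carg z)).
Proof.
move=> /G1P[/andP[n1 n2] iz]; rewrite carg_upper//.
have /andP[l u] := Re_div_normc_itv iz.
have n0 : 0 < normc z by lra.
rewrite acosK ?in_itv/= ?ltW// sin_acos ?ltW//.
rewrite mulrCA divff ?gt_eqF// mulr1.
rewrite (_ : 1 - _ = (complex.Im z / normc z) ^+ 2); last first.
  have := normc_sqr z; move: (normc z) n0 => r r0 rE.
  rewrite !expr_div_n [complex.Im z ^+ 2](_ : _ = r ^+ 2 - complex.Re z ^+ 2).
    by field; rewrite gt_eqF.
  by rewrite rE addrAC subrr add0r.
rewrite sqrtr_sqr ger0_norm; last by rewrite divr_ge0// ltW.
by rewrite mulrCA divff ?gt_eqF// mulr1; case: (z).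
Qed.

Lemma G1_open z : G1 z -> exists2 d : R, 0 < d &
  forall h, normc h < d -> G1 (z + h).
Proof.
move=> /G1P[/andP[n1 n2] iz].
exists (Num.min (complex.Im z) (Num.min (normc z - 1 / 2) (1 - normc z))).
  by rewrite !lt_min iz !subr_gt0 n1 n2.
move=> h; rewrite !lt_min => /and3P[h1 h2 h3]; apply/G1P.
have := le_normcD z h; have := ler_normcB z (- h); rewrite opprK normcN => a b.
split; first by apply/andP; split; lra.
have := ler_Im_normc h; rewrite ImD => /ler_normlP[]; lra.
Qed.

Lemma continuous_carg z : G1 z -> {for z, continuous (@carg R : R[i]^o -> R)}.
Proof.
move=> Gz; have /G1P[/andP[n1 _] iz] := Gz.
have : {for (z : R[i]^o), continuous
    (fun z : R[i]^o => acos (complex.Re z / normc z))}.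
  apply: (@continuous_comp R[i]^o R R (fun z => complex.Re z / normc z) acos).
    apply: (@cvgM _ _ (nbhs (z : R[i]^o)) _ (@complex.Re R)
      (fun z => (normc z)^-1) (complex.Re z) (normc z)^-1).
      exact: (@continuous_Re z).
    apply: (@cvgV _ _ (nbhs (z : R[i]^o)) _ (@normc R) (normc z)).
      by rewrite gt_eqF//; lra.
    exact: (@continuous_normc z).
  by apply: continuous_acos; exact: Re_div_normc_itv.
move=> h; rewrite /prop_for /continuous_at carg_upper//.
apply: cvg_trans h; apply: (@near_eq_cvg _ _ _ (nbhs_filter (z : R[i]^o))).
have Im0 : \forall y \near (z : R[i]^o), 0 < complex.Im y.
  by have /cvgr_gt := @continuous_Im z; apply.
by apply: (filterS _ Im0) => y /carg_upper ->.
Qed.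

End Plane.

(** * Sectors and kernels *)

Section Sectors.
Context {R : realType}.
Notation theta := (@Defs.theta R).
Notation radius := (@Defs.radius R).
Notation peak := (@Defs.peak R).

Definition sq (n : nat) : R := n.+1%:R ^+ 2.

Lemma sq_ge1 n : 1 <= sq n.
Proof. by rewrite /sq -natrX ler1n expn_gt0. Qed.

Lemma sq_gt0 n : 0 < sq n.
Proof. exact: lt_le_trans ltr01 (sq_ge1 n). Qed.

Lemma radius_gt0 n : 0 < radius n.
Proof. by rewrite /Defs.radius divr_gt0// mulr_gt0// ?exprn_gt0. Qed.

Lemma sector_bounds n : [/\ radius n < theta n, theta n <= 1 / 2,
  theta n + radius n < peak n & peak n <= 1 / n.+1%:R].
Proof.
rewrite /Defs.peak /Defs.radius /Defs.theta; set N : R := n.+1%:R.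
have N1 : 1 <= N by rewrite ler1n.
have N0 : 0 < N by lra.
have [i0 i1] : 0 < N^-1 /\ N^-1 <= 1 by rewrite invr_gt0 invf_le1.
have -> : 1 / (2 * N) = N^-1 / 2 by field; rewrite gt_eqF.
have -> : 1 / (2 ^+ 4 * N ^+ 2) = N^-1 ^+ 2 / 16 by field; rewrite gt_eqF.
have -> : 1 / (2 ^+ 5 * N ^+ 2) = N^-1 ^+ 2 / 32 by field; rewrite gt_eqF.
rewrite [1 / N]mul1r; move: (N^-1) i0 i1 => x x0 x1.
have x2 : x ^+ 2 <= x by rewrite expr2 ler_piMl// ltW.
have x3 : 0 < x ^+ 2 by rewrite exprn_gt0.
by split; lra.
Qed.

Lemma theta_gap n m : (n < m)%N -> theta m + radius m < theta n - radius n.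
Proof.
move=> nm; rewrite /Defs.theta /Defs.radius.
set N : R := n.+1%:R; set M : R := m.+1%:R.
have N1 : 1 <= N by rewrite ler1n.
have NM : N + 1 <= M by rewrite /N /M natr1 ler_nat.
have N0 : 0 < N by lra.
have M0 : 0 < M by lra.
set x := N^-1; set y := M^-1.
have xN : x * N = 1 by rewrite mulVf// gt_eqF.
have yM : y * M = 1 by rewrite mulVf// gt_eqF.
have x0 : 0 < x by rewrite invr_gt0.
have y0 : 0 < y by rewrite invr_gt0.
have -> : 1 / (2 * N) = x / 2 by rewrite /x; field; rewrite gt_eqF.
have -> : 1 / (2 * M) = y / 2 by rewrite /y; field; rewrite gt_eqF.
have -> : 1 / (2 ^+ 5 * N ^+ 2) = x ^+ 2 / 32 by rewrite /x; field; rewrite gt_eqF.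
have -> : 1 / (2 ^+ 5 * M ^+ 2) = y ^+ 2 / 32 by rewrite /y; field; rewrite gt_eqF.
(* The separation [N + 1 <= M] enters here, as [1 / N - 1 / M = (M - N) / (N * M)]. *)
have xy : x * y <= x - y.
  have -> : x - y = x * y * (M - N) by rewrite mulrBr -mulrA yM mulr1 mulrAC xN mul1r.
  by rewrite ler_peMr ?mulr_ge0 ?(ltW x0) ?(ltW y0)//; lra.
have x1 : x <= 1 by rewrite -xN ler_peMr// ltW.
(* If [x <= 2 * y], then [x ^+ 2 <= 2 * (x * y)] and [xy] applies; otherwise
   [2 * (x - y) > x >= x ^+ 2]. *)
have x2 : x ^+ 2 <= 2 * (x - y).
  by rewrite expr2; have [h|h] := leP x (2 * y); nra.
have xy0 : 0 < x * y by rewrite mulr_gt0.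
have y2 : y ^+ 2 <= x * y by rewrite expr2; nra.
by lra.
Qed.

Lemma sector_inj n m (t : R) : `|t - theta n| <= radius n ->
  `|t - theta m| <= radius m -> n = m.
Proof.
move=> /ler_normlP[n1 n2] /ler_normlP[m1 m2].
by case: (ltngtP n m) => // /theta_gap h; exfalso; lra.
Qed.

Lemma theta_itv n : 0 < theta n < pi.
Proof.
have [a b _ _] := sector_bounds n; have := radius_gt0 n.
by have := @pi_ge2 R => h1 h2; apply/andP; split; lra.
Qed.

End Sectors.

(** * Two-sided bounds for the angular profile *)

Section Profile.
Context {R : realType} (lam : nat -> nat -> {posnum R}).
Context (hat : nat -> R -> {posnum R}).
Notation theta := (@Defs.theta R).
Notation radius := (@Defs.radius R).
Notation peak := (@Defs.peak R).
Hypothesis lam_bounds : forall k n, 1 / n.+1%:R ^+ 2 <= (lam k n)%:num <= 1.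
Hypothesis hat_profile : angular_profile lam hat.

Lemma affine_on_cst (c a b : R) : affine_on (fun=> c) a b.
Proof. by exists 0, c => t _; rewrite mul0r add0r. Qed.

(** An affine piece lies between bounds valid at its endpoints. On [[peak n.+1, peak n]] the
    breakpoint values are in [[1 / n.+1%:R ^+ 2, 1]] and [t <= 1 / n.+1%:R]; on the last piece the
    profile is 1 and [t < 4], whence the 16. *)
Lemma hat_bounds k t : 0 < t < pi -> t ^+ 2 / 16 <= (hat k t)%:num <= 1.
Proof.
move=> /andP[t0 tpi].
have [tp|pt] := ltP t (peak 0); last first.
  have pie : peak 0 <= pi :> R by rewrite (le_trans pt)// ltW.
  have h (a : R) : a = 1 -> a <= 1 /\ 1 <= a by move=> ->.
  have hp := h _ (hat_peak hat_profile k 0%N); have hpi := h _ (hat_pi hat_profile k).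
  have aff := hat_affine_last hat_profile k.
  have t_itv : peak 0 <= t <= pi by rewrite pt ltW.
  rewrite (affine_on_le aff (affine_on_cst 1 _ _) hp.1 hpi.1 t_itv) andbT.
  apply: le_trans (affine_on_le (affine_on_cst 1 _ _) aff hp.2 hpi.2 t_itv).
  have t4 : t < 4 by apply: (lt_trans tpi); have := @pihalf_lt2 R; lra.
  by nra.
have [n /andP[pnt tpn]] := peak_cover t0 tp.
have [s1 s2 s3 s4] := @sector_bounds R n; have r0 := @radius_gt0 R n.
have [q1 q2 q3 q4] := @sector_bounds R n.+1.
have t2 : t ^+ 2 / 16 <= 1 / n.+1%:R ^+ 2.
  have tn : t <= 1 / n.+1%:R by exact: le_trans s4.
  apply: (@le_trans _ _ (t ^+ 2)); first by nra.
  move: tn; rewrite !ler_pdivlMr ?exprn_gt0// -exprMn => tn.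
  by rewrite expr_le1// mulr_ge0// ltW.
suff /andP[h1 ->] : 1 / n.+1%:R ^+ 2 <= (hat k t)%:num <= 1.
  by rewrite andbT (le_trans t2).
have n1 : 1 / n.+1%:R ^+ 2 <= 1 :> R by have /andP[] := lam_bounds 0%N n; exact: le_trans.
have pe m : 1 / n.+1%:R ^+ 2 <= (hat k (peak m))%:num /\ (hat k (peak m))%:num <= 1.
  by rewrite (hat_peak hat_profile).
have pl s : theta n - radius n <= s <= theta n + radius n ->
    1 / n.+1%:R ^+ 2 <= (hat k s)%:num /\ (hat k s)%:num <= 1.
  by move=> /(hat_plateau hat_profile k) ->; apply/andP; exact: lam_bounds.
have pll : theta n - radius n <= theta n - radius n <= theta n + radius n.
  by rewrite lexx; lra.
have plr : theta n - radius n <= theta n + radius n <= theta n + radius n.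
  by rewrite lexx andbT; lra.
have [t1|t1] := leP t (theta n - radius n).
  have aff := hat_affine_right hat_profile k n.
  have t_itv : peak n.+1 <= t <= theta n - radius n by rewrite pnt.
  rewrite (affine_on_le aff (affine_on_cst 1 _ _) (pe _).2 (pl _ pll).2 t_itv) andbT.
  exact: (affine_on_le (affine_on_cst _ _ _) aff (pe _).1 (pl _ pll).1 t_itv).
have [t3|t3] := leP t (theta n + radius n).
  by apply/andP; apply: pl; rewrite t3 ltW.
have aff := hat_affine_left hat_profile k n.
have t_itv : theta n + radius n <= t <= peak n by rewrite tpn ltW.
rewrite (affine_on_le aff (affine_on_cst 1 _ _) (pl _ plr).2 (pe _).2 t_itv) andbT.
exact: (affine_on_le (affine_on_cst _ _ _) aff (pl _ plr).1 (pe _).1 t_itv).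
Qed.

Lemma hat_sector k n t : `|t - theta n| <= radius n -> (hat k t)%:num = (lam k n)%:num.
Proof.
move=> /ler_normlP[a b]; apply: (hat_plateau hat_profile); apply/andP; split; lra.
Qed.

End Profile.

(** * Kernels peaking at the nodes and small off their sectors *)

Section Kernels.
Context {R : realType}.
Notation theta := (@Defs.theta R).
Notation radius := (@Defs.radius R).

(** A lower bound for the squared distance from [pole n] to points of [G1] off the n-th sector,
    whatever [eps n] is. *)
Definition gap n : R := 1 - cos (radius n).

(** Tuned so that [sq n * (2 * eps n / sqrt (gap n))] is exactly [8^-1 / 2 ^+ n]: the off-sector
    kernels, even multiplied by [sq n], then sum to at most 1/4. *)
Definition eps n : R := Num.sqrt (gap n) / (16 * 2 ^+ n * sq n).

Definition polar (r t : R) : R[i] := (r * cos t) +i* (r * sin t).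

Definition node n : R[i] := polar (1 - eps n) (theta n).
Definition pole n : R[i] := polar (1 + eps n) (theta n).

Definition kernel n (z : R[i]) : R[i] := polar (2 * eps n) (theta n) / (pole n - z).

Lemma normc_polar r t : normc (polar r t) = `|r|.
Proof.
by rewrite /= !exprMn -mulrDr cos2Dsin2 mulr1 sqrtr_sqr.
Qed.

Lemma radius_lt_pi n : radius n < pi.
Proof.
have [a b _ _] := @sector_bounds R n.
by have := @pi_ge2 R; lra.
Qed.

Lemma gap_gt0 n : 0 < gap n.
Proof.
rewrite /gap subr_gt0 -{1}(@cos0 R) ltr_cos ?radius_gt0// in_itv/= ?lexx ?pi_ge0//.
by rewrite ?(ltW (radius_gt0 _)) ?(ltW (radius_lt_pi _)).
Qed.

Lemma sqrt_gap n : 0 < Num.sqrt (gap n) <= 2.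
Proof.
rewrite sqrtr_gt0 gap_gt0/=; have := cos_geN1 (radius n) => h.
have -> : 2 = Num.sqrt (2 ^+ 2) :> R by rewrite sqrtr_sqr ger0_norm.
by rewrite ler_wsqrtr// /gap; lra.
Qed.

Lemma scale_gt0 n : 0 < 16 * 2 ^+ n * sq n :> R.
Proof. by rewrite !mulr_gt0 ?exprn_gt0 ?sq_gt0. Qed.

Lemma eps_gt0 n : 0 < eps n.
Proof. by rewrite divr_gt0 ?scale_gt0//; have /andP[] := sqrt_gap n. Qed.

Lemma eps_sq n : sq n * eps n <= 8^-1 / 2 ^+ n.
Proof.
have -> : sq n * eps n = Num.sqrt (gap n) / 2 * (8^-1 / 2 ^+ n).
  rewrite /eps; field; rewrite expf_neq0// gt_eqF//; exact: sq_gt0.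
rewrite ler_piMl// ?divr_ge0 ?exprn_ge0//; have /andP[] := sqrt_gap n; lra.
Qed.

Lemma eps_le n : eps n <= 1 / 8.
Proof.
apply: (@le_trans _ _ (sq n * eps n)).
  by rewrite ler_peMl ?sq_ge1// ltW ?eps_gt0.
apply: (le_trans (eps_sq n)); rewrite mul1r ler_piMr//.
by rewrite invf_le1 ?exprn_gt0// -natrX ler1n expn_gt0.
Qed.

Lemma carg_node n : carg (node n) = theta n.
Proof.
rewrite /node /polar carg_polar//; first by have := eps_le n; lra.
by have /andP[/ltW -> /ltW ->] := @theta_itv R n.
Qed.

Lemma normc_node n : normc (node n) = 1 - eps n.
Proof. by rewrite normc_polar gtr0_norm//; have := eps_le n; lra. Qed.

Lemma G1_node n : G1 (node n).
Proof.
split; last by rewrite carg_node theta_itv.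
by rewrite normc_node; have := eps_le n; have := eps_gt0 n; lra.
Qed.

Lemma polarB r s t : polar r t - polar s t = polar (r - s) t.
Proof. by apply/eqP; rewrite eq_complex /= !mulrBl !eqxx. Qed.

Lemma kernel_node n : kernel n (node n) = 1.
Proof.
rewrite /kernel polarB (_ : 1 + _ - _ = 2 * eps n); last by ring.
rewrite divff//; apply: contraTneq (eps_gt0 n) => h.
have := normc_polar (2 * eps n) (theta n); rewrite h normc0 => /esym/normr0P.
by rewrite mulf_eq0 pnatr_eq0/= => /eqP ->; rewrite ltxx.
Qed.

Lemma normc_kernel n z : normc (kernel n z) = 2 * eps n / normc (pole n - z).
Proof.
rewrite normcM normcV normc_polar gtr0_norm//.
by rewrite mulr_gt0 ?eps_gt0.
Qed.

Lemma pole_dist n z : 1 + eps n - normc z <= normc (pole n - z).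
Proof.
apply: le_trans (ler_normcB _ _).
by rewrite normc_polar gtr0_norm// addr_gt0 ?eps_gt0.
Qed.

Lemma kernel_le2 n z : normc z < 1 -> normc (kernel n z) <= 2.
Proof.
move=> z1; have := pole_dist n z; have := eps_gt0 n => e0 h.
by rewrite normc_kernel ler_pdivrMr; nra.
Qed.

(** The law of cosines, arranged as a radial part plus an angular part. *)
Lemma pole_polar_dist n r t :
  normc (pole n - polar r t) ^+ 2 =
  (1 + eps n - r) ^+ 2 + 2 * (1 + eps n) * r * (1 - cos (t - theta n)).
Proof.
rewrite normc_sqr /= cosB.
have := cos2Dsin2 t; have := cos2Dsin2 (theta n).
by set e := 1 + eps n; move: (cos t) (sin t) (cos _) (sin _) => c s c' s' h h'; nra.
Qed.

(** Since [normc z > 1 / 2], the factor of the angular part in [pole_polar_dist] is at least 1. As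
    the angular distance lies in [[radius n, pi]], where cosine decreases, the squared distance to
    the pole is at least [gap n]. *)
Lemma kernel_off_sector n z : G1 z -> radius n <= `|carg z - theta n| ->
  sq n * normc (kernel n z) <= 8^-1 / 2 ^+ n.
Proof.
move=> Gz off; have [/andP[r1 r2] /andP[t1 t2]] := Gz.
have e0 := eps_gt0 n; have g0 := gap_gt0 n.
have /andP[th1 th2] := @theta_itv R n.
have cg : gap n <= 1 - cos (carg z - theta n).
  rewrite lerD2l lerN2 -[in leLHS]cos_norm.
  have tp : `|carg z - theta n| <= pi by rewrite ler_norml; apply/andP; split; lra.
  rewrite leNgt ltr_cos -?leNgt// in_itv/= ?normr_ge0//.
  by rewrite ?(ltW (radius_gt0 _)) ?(ltW (radius_lt_pi _)).
have d2 : gap n <= normc (pole n - z) ^+ 2.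
  rewrite [z in normc (_ - z)](polar_form Gz) pole_polar_dist.
  have : 1 * (1 - cos (carg z - theta n)) <=
      2 * (1 + eps n) * normc z * (1 - cos (carg z - theta n)).
    by apply: ler_wpM2r; [lra|nra].
  by have := sqr_ge0 (1 + eps n - normc z); lra.
have d1 : Num.sqrt (gap n) <= normc (pole n - z).
  by rewrite -[leRHS]ger0_norm ?normc_ge0// -sqrtr_sqr ler_wsqrtr.
have /andP[s0 _] := sqrt_gap n.
rewrite normc_kernel; apply: (@le_trans _ _ (sq n * (2 * eps n / Num.sqrt (gap n)))).
  apply: ler_wpM2l; first exact: ltW (sq_gt0 n).
  apply: ler_wpM2l; first by rewrite mulr_ge0// ltW.
  by rewrite lef_pV2// posrE// (lt_le_trans s0).
rewrite le_eqVlt; apply/orP; left; apply/eqP; rewrite /eps; field.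
by rewrite !gt_eqF// ?exprn_gt0 ?sq_gt0.
Qed.

End Kernels.

(** * Synthesis and the Neumann series *)

Section Synthesis.
Context {R : realType}.
Implicit Types (x y : nat -> R[i]) (z : R[i]).

(** The ball of radius [C] in the sup space with weight [1 / n^2]. Elements of [K_infty] and node
    samples of functions in [HW_bar] lie in such balls, and the operators below are estimated on
    them. *)
Definition tempered (C : R) x : Prop := forall n, normc (x n) <= C * sq n.

Definition synth x z : R[i] := csum (fun n => x n * kernel n z).

Lemma tempered_ge0 C x : tempered C x -> 0 <= C.
Proof.
move=> /(_ 0%N); rewrite /sq expr1n mulr1; apply: le_trans; exact: normc_ge0.
Qed.

Lemma temperedZD a C C' x y : tempered C x -> tempered C' y ->
  tempered (normc a * C + C') (fun n => a * x n + y n).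
Proof.
move=> xC yC n; apply: (le_trans (le_normcD _ _)); rewrite mulrDl normcM -mulrA.
by apply: lerD => //; apply: ler_wpM2l; [exact: normc_ge0|exact: xC].
Qed.

Lemma synth_is C x z : tempered C x -> normc z < 1 ->
  is_csum (fun n => x n * kernel n z) (synth x z).
Proof.
move=> xC z1; have C0 := tempered_ge0 xC.
(* The pole is at distance at least [1 - normc z], and [2 * C * 8^-1 = C / 4] by [eps_sq]. *)
apply: (@csum_is _ _ (C / 4 / (1 - normc z))) => n.
rewrite normcM normc_kernel.
have d : 1 - normc z <= normc (pole n - z).
  by apply: le_trans (pole_dist n z); have := @eps_gt0 R n; lra.
have e0 := @eps_gt0 R n.
apply: (@le_trans _ _ (C * sq n * (2 * eps n / (1 - normc z)))).
  apply: ler_pM => //; first exact: normc_ge0.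
    by rewrite divr_ge0 ?normc_ge0// mulr_ge0// ltW.
  apply: ler_wpM2l; first by rewrite mulr_ge0// ltW.
  by rewrite lef_pV2// posrE; lra.
rewrite (_ : _ * _ = 2 * C / (1 - normc z) * (sq n * eps n)); last first.
  by field; rewrite gt_eqF// subr_gt0.
rewrite (_ : C / 4 / _ / _ = 2 * C / (1 - normc z) * (8^-1 / 2 ^+ n)); last first.
  by field; rewrite expf_neq0// gt_eqF// subr_gt0.
apply: ler_wpM2l; last exact: eps_sq.
by rewrite divr_ge0 ?mulr_ge0// subr_ge0 ltW.
Qed.

Lemma synthZD a C C' x y z : tempered C x -> tempered C' y -> normc z < 1 ->
  synth (fun n => a * x n + y n) z = a * synth x z + synth y z.
Proof.
move=> xC yC z1; apply: csumP.
rewrite (_ : (fun n => _) =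
    (fun n => a * (x n * kernel n z) + y n * kernel n z)).
  by apply: is_csumZD; exact: synth_is.
by apply/funext => n; rewrite mulrDl mulrA.
Qed.

(** Applied to the indices of the sectors containing a given point; there is at most one. *)
Lemma sum_unique_le (I : pred nat) (b : R) N : 0 <= b ->
  (forall n m, I n -> I m -> n = m) ->
  \sum_(n < N) (if I n then b else 0) <= b.
Proof.
move=> b0 I1; rewrite -big_mkcond /=.
have [m Im|nI] := pickP (fun n : 'I_N => I n); last first.
  by rewrite big_pred0.
rewrite (bigD1 m)//= big_pred0 ?addr0// => n.
by apply/negP => /andP[In /eqP]; apply; apply/val_inj/I1.
Qed.

(** The terms off their sectors add up to at most [C / 4]; at most one term is on its sector, and
    there the kernel is bounded by 2. *)
Lemma synth_le C B (v : R) x z : tempered C x -> G1 z -> 0 < v -> 0 <= B ->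
  (forall n, `|carg z - Defs.theta n| <= Defs.radius n -> v * normc (x n) <= B) ->
  v * normc (synth x z) <= v * (C / 4) + 2 * B.
Proof.
move=> xC Gz v0 B0 vB; have [/andP[_ z1] _] := Gz.
have C0 := tempered_ge0 xC.
rewrite mulrC -ler_pdivlMr//.
apply: (is_csum_le (synth_is xC z1)) => N; apply: (le_trans (normc_sum _ _ _)).
pose I n := `|carg z - Defs.theta n| <= Defs.radius n.
apply: (@le_trans _ _ (\sum_(n < N) (C / 8 / 2 ^+ n + (if I n then 2 * B / v else 0)))).
  apply: ler_sum => n _; rewrite normcM.
  case: ifPn => [In|nI].
    apply: (@le_trans _ _ (B / v * 2)).
      apply: ler_pM; rewrite ?normc_ge0 ?kernel_le2//.
      by rewrite ler_pdivlMr// mulrC vB.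
    rewrite (_ : B / v * 2 = 2 * B / v); last by field; rewrite gt_eqF.
    by rewrite lerDr !divr_ge0// exprn_ge0.
  rewrite addr0; apply: (@le_trans _ _ (C * (sq n * normc (kernel n z)))).
    by rewrite mulrA; apply: ler_wpM2r; [exact: normc_ge0|exact: xC].
  rewrite -(mulrA C 8^-1); apply: ler_wpM2l => //; apply: kernel_off_sector => //.
  by apply: ltW; rewrite ltNge.
rewrite big_split /=.
have h1 : \sum_(n < N) C / 8 / 2 ^+ n <= 2 * (C / 8).
  by apply: sum_geometric_le; rewrite divr_ge0.
have h2 : \sum_(n < N) (if I n then 2 * B / v else 0) <= 2 * B / v.
  apply: (@sum_unique_le I) => [|n m]; last exact: sector_inj.
  by rewrite divr_ge0 ?mulr_ge0// ltW.
apply: (le_trans (lerD h1 h2)).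
rewrite [leRHS](_ : _ = C / 4 + 2 * B / v); last by field; rewrite gt_eqF.
by rewrite lerD2r; lra.
Qed.

Lemma normc_node_lt1 n : normc (@node R n) < 1.
Proof. by rewrite normc_node gtrBl eps_gt0. Qed.

(* At the nodes the synthesis operator is a small perturbation of the identity,
   because [sum_n n^2 |kernel n|] over the off-diagonal terms is at most [1/4]. *)
Lemma synth_node_diff C x m : tempered C x ->
  normc (x m - synth x (node m)) <= C / 4.
Proof.
move=> xC; have z1 := normc_node_lt1 m; have C0 := tempered_ge0 xC.
have := is_csumZD (-1) (synth_is xC z1) (is_csum_delta m (x m)).
rewrite mulN1r addrC => /is_csum_le; apply => N.
apply: (le_trans (normc_sum _ _ _)).
apply: (@le_trans _ _ (\sum_(n < N) C / 8 / 2 ^+ n)); last first.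
  by apply: (le_trans (sum_geometric_le _ _)); [rewrite divr_ge0|lra].
apply: ler_sum => n _; rewrite mulN1r.
case: eqP => [->|nm].
  by rewrite kernel_node mulr1 addNr normc0 !divr_ge0// exprn_ge0.
rewrite addr0 normcN normcM.
apply: (@le_trans _ _ (C * (sq n * normc (kernel n (node m))))).
  by rewrite mulrA; apply: ler_wpM2r; [exact: normc_ge0|exact: xC].
rewrite -(mulrA C 8^-1); apply: ler_wpM2l => //; apply: kernel_off_sector.
  exact: G1_node.
rewrite carg_node leNgt; apply/negP => /ltW h; apply: nm.
by apply: (sector_inj h); rewrite subrr normr0 ltW// radius_gt0.
Qed.

Lemma temperedB C x : tempered C x ->
  tempered (C / 4) (fun m => x m - synth x (node m)).
Proof.
move=> xC m; apply: (le_trans (synth_node_diff m xC)).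
by rewrite ler_peMr ?sq_ge1// divr_ge0 ?(tempered_ge0 xC).
Qed.

(** Such an [x] is fixed by the map of [temperedB], so its constant can be divided by 4
    indefinitely. *)
Lemma synth_inj C x : tempered C x -> (forall m, synth x (node m) = 0) ->
  forall n, x n = 0.
Proof.
move=> xC x0 n; have C0 := tempered_ge0 xC.
have xj j : tempered (C / 4 ^+ j) x.
  elim: j => [|j IH]; first by rewrite expr0 divr1.
  have := temperedB IH; rewrite exprSr invfM mulrA.
  rewrite (_ : (fun m => _) = x)//.
  by apply/funext => m; rewrite x0 subr0.
apply: eq0_normc; apply/eqP; rewrite eq_le normc_ge0 andbT.
apply: (@ler0_geometric _ _ (C * sq n)) => j; apply: (le_trans (xj j n)).
rewrite mulrAC; apply: ler_wpM2l; first by rewrite mulr_ge0// ltW// sq_gt0.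
rewrite lef_pV2 ?posrE ?exprn_gt0//.
by rewrite lerXn2r ?nnegrE ?ler_nat.
Qed.

(** The iterates [(I - S)^j y], where [S] is synthesis followed by sampling at the nodes; their sum
    over [j] is [S^-1 y]. *)
Fixpoint neumann y j : nat -> R[i] :=
  if j is j.+1 then (fun m => neumann y j m - synth (neumann y j) (node m))
  else y.

Lemma neumann_tempered C y j : tempered C y -> tempered (C / 4 ^+ j) (neumann y j).
Proof.
move=> yC; elim: j => [|j IH]; first by rewrite expr0 divr1.
by rewrite exprSr invfM mulrA; exact: temperedB.
Qed.

(** The sum telescopes. Temperedness of the partial sums is carried along because additivity of
    [synth] requires it. *)
Lemma synth_neumann_sum C y J : tempered C y ->
  (exists C', tempered C' (fun m => \sum_(j < J) neumann y j m)) /\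
  forall m, synth (fun m => \sum_(j < J) neumann y j m) (node m) =
            y m - neumann y J m.
Proof.
move=> yC; elim: J => [|J [[C' IH1] IH2]].
  have z0 : tempered 0 (fun m => \sum_(j < 0) neumann y j m).
    by move=> m; rewrite big_ord0 normc0 mul0r.
  split=> [|m]; first by exists 0.
  rewrite /= subrr; have := synthZD (-1) z0 z0 (normc_node_lt1 m).
  rewrite mulN1r addNr => h; rewrite -[RHS]h; congr synth; apply/funext => n.
  by rewrite !big_ord0 mulr0 addr0.
have dJ := neumann_tempered J yC.
rewrite (_ : (fun m => _) =
    (fun m => 1 * (\sum_(j < J) neumann y j m) + neumann y J m)); last first.
  by apply/funext => m; rewrite big_ord_recr/= mul1r.
split=> [|m]; first by eexists; exact: temperedZD IH1 dJ.
rewrite (synthZD _ IH1 dJ (normc_node_lt1 m)) mul1r IH2 /=.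
by rewrite opprB addrA addrAC.
Qed.

Lemma synth_surj C y : tempered C y ->
  exists2 x, tempered (4 * C) x & forall m, synth x (node m) = y m.
Proof.
move=> yC; have C0 := tempered_ge0 yC.
(* The decay [4 ^- j] is weakened to [2 ^- j], the rate that [csum] is built for. *)
have dC m j : normc (neumann y j m) <= C * sq m / 2 ^+ j.
  apply: (le_trans (neumann_tempered j yC m)); rewrite mulrAC.
  apply: ler_wpM2l; first by rewrite mulr_ge0// ltW// sq_gt0.
  by rewrite lef_pV2 ?posrE ?exprn_gt0// lerXn2r ?nnegrE ?ler_nat.
pose x m := csum (fun j => neumann y j m).
pose r J m := x m - \sum_(j < J) neumann y j m.
have rC J : tempered (4 * C / 2 ^+ J) (r J).
  move=> m; apply: (le_trans (csum_tail _ (dC m))).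
  by rewrite mulrA mulrAC.
have xC : tempered (4 * C) x.
  have := rC 0%N; rewrite expr0 divr1 (_ : r 0%N = x)//.
  by apply/funext => m; rewrite /r big_ord0 subr0.
exists x => // m; apply/eqP; rewrite -subr_eq0; apply/eqP/eq0_normc.
apply/eqP; rewrite eq_le normc_ge0 andbT.
apply: (@ler0_geometric _ _ (6 * C * sq m)) => J.
have [[C' SC] SJ] := synth_neumann_sum J yC.
(* With [x = r J + partial sum], the error is [S (r J) - neumann y J]. In units of
   [C * sq m / 2 ^+ J] the three summands cost 1, 4 and 1, hence the 6 above. *)
have -> : synth x (node m) - y m =
    - (r J m - synth (r J) (node m)) + r J m - neumann y J m.
  have := synthZD 1 (rC J) SC (normc_node_lt1 m).
  rewrite SJ mul1r (_ : (fun n => _) = x) => [->|]; first by ring.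
  by apply/funext => n; rewrite /r mul1r subrK.
apply: (le_trans (le_normcD _ _)); rewrite normcN.
have q0 : 0 <= C / 2 ^+ J by rewrite divr_ge0// exprn_ge0.
have h1 := le_normcD (- (r J m - synth (r J) (node m))) (r J m).
rewrite normcN in h1; have h2 := synth_node_diff m (rC J).
have h3 := rC J m; have h4 := dC m J.
have E1 : 4 * C / 2 ^+ J = 4 * (C / 2 ^+ J) by rewrite mulrA.
have E2 : C * sq m / 2 ^+ J = C / 2 ^+ J * sq m by rewrite mulrAC.
have E3 : 6 * C * sq m / 2 ^+ J = 6 * (C / 2 ^+ J * sq m) by field; rewrite expf_neq0.
have h5 : C / 2 ^+ J <= C / 2 ^+ J * sq m by rewrite ler_peMr// sq_ge1.
rewrite E1 in h2 h3; rewrite -(mulrA 4 (C / _)) in h3; rewrite E2 in h4.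
by rewrite E3; lra.
Qed.

(** The inverse of sampling after synthesis on tempered sequences, chosen by [xget] and pinned down
    by [coef_unique]; the value is 0 where no tempered preimage exists. *)
Definition coef y : nat -> R[i] :=
  xget (fun=> 0) [set x | (exists C, tempered C x) /\
                          forall m, synth x (node m) = y m].

Lemma coef_unique C x y : tempered C x -> (forall m, synth x (node m) = y m) ->
  coef y = x.
Proof.
move=> xC xy; rewrite /coef; case: xgetP => [x' _ [[C' x'C] x'y]|/(_ x)]; last first.
  by case; split; first by exists C.
apply/funext => n; apply/eqP; rewrite -subr_eq0; apply/eqP.
have := synth_inj (temperedZD (-1) xC x'C) _ n; rewrite mulN1r addrC; apply => m.
by rewrite (synthZD _ xC x'C (normc_node_lt1 m)) xy x'y mulN1r addNr.
Qed.

Lemma coefP C y : tempered C y ->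
  tempered (4 * C) (coef y) /\ forall m, synth (coef y) (node m) = y m.
Proof. by move=> /synth_surj[x xC xy]; rewrite (coef_unique xC xy). Qed.

Lemma coefZD a C C' y y' : tempered C y -> tempered C' y' ->
  coef (fun n => a * y n + y' n) = (fun n => a * coef y n + coef y' n).
Proof.
move=> /coefP[yC ys] /coefP[yC' ys'].
apply: (coef_unique (temperedZD a yC yC')) => m.
by rewrite (synthZD _ yC yC' (normc_node_lt1 m)) ys ys'.
Qed.

(* The correction [coef y - y] is bounded, hence harmless for every weight. *)
Lemma coef_diff C y n : tempered C y -> normc (coef y n - y n) <= C.
Proof.
move=> /coefP[yC <-]; apply: (le_trans (synth_node_diff n yC)); lra.
Qed.

End Synthesis.

(** * Holomorphy *)

Section Holomorphy.
Context {R : realType}.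
Implicit Types (x : nat -> R[i]) (z h : R[i]).

Lemma derivable_of_remainder (f : R[i]^o -> R[i]^o) (z D : R[i]) (C d : R) :
  0 < d -> (forall h, normc h < d ->
    normc (f (z + h) - f z - h * D) <= C * normc h ^+ 2) ->
  derivable f (z : R[i]^o) 1.
Proof.
move=> d0 fD; apply/cvg_ex; exists D.
apply/(@cvgrPdist_lt _ _ _ _ (@dnbhs_filter R[i]^o 0)) => e e0.
have [r rE] : exists r : R, e = r%:C.
  by apply/complex_realP; rewrite realE ltW.
move: e0; rewrite {}rE ltcR => r0.
have C0 : 0 < `|C| + 1 by rewrite ltr_wpDl.
have t0 : 0 < Num.min d (r / (`|C| + 1)) by rewrite lt_min d0 divr_gt0.
apply/nbhs_ballP; exists (Num.min d (r / (`|C| + 1)))%:C; first by rewrite /= ltcR.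
move=> h; rewrite /ball /= sub0r normrN normc_of_norm ltcR lt_min.
move=> /andP[hd hr] h0; rewrite normc_of_norm ltcR /GRing.scale /= mulr1.
have n0 : 0 < normc h.
  by rewrite lt_neqAle normc_ge0 andbT eq_sym; apply: contra_neq h0; exact: eq0_normc.
have -> : D - h^-1 * (f (h + z) - f z) = - (h^-1 * (f (z + h) - f z - h * D)).
  by rewrite [in RHS]mulrBr mulrA mulVf// mul1r opprB [h + z]addrC.
rewrite normcN normcM normcV mulrC ltr_pdivrMr//.
apply: (le_lt_trans (fD h hd)); rewrite expr2 mulrA ltr_pM2r//.
apply: (@le_lt_trans _ _ ((`|C| + 1) * normc h)).
  by apply: ler_wpM2r; [exact: ltW|apply: (le_trans (ler_norm _)); rewrite lerDl].
by rewrite mulrC -ltr_pdivlMr.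
Qed.

(** The complex derivative of [kernel n]. *)
Definition dkernel n z : R[i] := polar (2 * eps n) (Defs.theta n) / (pole n - z) ^+ 2.

Lemma pole_neq n z : normc z < 1 -> pole n - z != 0.
Proof.
move=> z1; apply/eqP => h; have := pole_dist n z; rewrite h normc0.
by have := @eps_gt0 R n; lra.
Qed.

Lemma kernel_remainder n z h : normc z < 1 -> normc (z + h) < 1 ->
  kernel n (z + h) - kernel n z - h * dkernel n z =
  polar (2 * eps n) (Defs.theta n) * h ^+ 2 /
    ((pole n - (z + h)) * (pole n - z) ^+ 2).
Proof.
move=> /(pole_neq n) a0 /(pole_neq n) b0; rewrite /kernel /dkernel.
by field; rewrite a0 b0.
Qed.

(** Termwise differentiation with an explicit quadratic remainder. The restriction on [h] keeps
    [z + h] at distance at least [rho / 2] from all poles, so the remainders of the kernels are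
    summable uniformly in [h]. *)
Lemma synth_remainder C x z h : tempered C x -> normc z < 1 ->
  normc h <= (1 - normc z) / 2 ->
  normc (synth x (z + h) - synth x z - h * csum (fun n => x n * dkernel n z))
    <= C / (1 - normc z) ^+ 3 * normc h ^+ 2.
Proof.
move=> xC z1 hz; set rho := 1 - normc z; have rho0 : 0 < rho by rewrite subr_gt0.
have C0 := tempered_ge0 xC.
have zh : normc (z + h) <= 1 - rho / 2.
  by have := le_normcD z h; rewrite /rho in hz *; lra.
have zh1 : normc (z + h) < 1 by lra.
have pz n : rho <= normc (pole n - z).
  by have := pole_dist n z; have := @eps_gt0 R n; rewrite /rho; lra.
have pzh n : rho / 2 <= normc (pole n - (z + h)).
  by have := pole_dist n (z + h); have := @eps_gt0 R n; lra.
have xe n : normc (x n) * (2 * eps n) <= C / 4 / 2 ^+ n.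
  have e0 := @eps_gt0 R n.
  apply: (@le_trans _ _ (C * sq n * (2 * eps n))).
    by apply: ler_wpM2r; [rewrite mulr_ge0// ltW|exact: xC].
  rewrite (_ : C * _ * _ = C * 2 * (sq n * eps n)); last by ring.
  rewrite (_ : C / 4 / _ = C * 2 * (8^-1 / 2 ^+ n)); last first.
    by field; rewrite expf_neq0.
  by apply: ler_wpM2l; [rewrite mulr_ge0|exact: eps_sq].
have np n : normc (polar (2 * eps n) (Defs.theta n)) = 2 * eps n.
  by rewrite normc_polar gtr0_norm// mulr_gt0 ?eps_gt0.
have dis : is_csum (fun n => x n * dkernel n z) (csum (fun n => x n * dkernel n z)).
  apply: (@csum_is _ _ (C / 4 / rho ^+ 2)) => n.
  rewrite /dkernel [leLHS](_ : _ = normc (x n) * (2 * eps n) *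
    (normc ((pole n - z) ^+ 2))^-1); last by rewrite normcM normcM normcV np mulrA.
  rewrite (_ : C / 4 / _ / _ = C / 4 / 2 ^+ n / rho ^+ 2); last by rewrite mulrAC.
  apply: ler_pM; last 1 first.
  - rewrite expr2 normcM -expr2 lef_pV2 ?posrE ?exprn_gt0//.
      by rewrite lerXn2r ?nnegrE// ?(ltW rho0)// normc_ge0.
    exact: lt_le_trans (pz n).
  - by rewrite mulr_ge0 ?normc_ge0// mulr_ge0// ltW// eps_gt0.
  - by rewrite invr_ge0 normc_ge0.
  - exact: xe.
have tot := is_csumZD (-1) (is_csumZD h dis (synth_is xC z1)) (synth_is xC zh1).
rewrite (_ : _ - _ - _ = -1 * (h * csum (fun n => x n * dkernel n z) + synth x z)
  + synth x (z + h)); last by ring.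
apply: (is_csum_le tot) => N; apply: (le_trans (normc_sum _ _ _)).
apply: (@le_trans _ _
  (\sum_(n < N) C / 2 / rho ^+ 3 * normc h ^+ 2 / 2 ^+ n)); last first.
  apply: (le_trans (sum_geometric_le _ _)).
    by rewrite mulr_ge0 ?exprn_ge0 ?normc_ge0// !divr_ge0// exprn_ge0// ltW.
  by rewrite le_eqVlt; apply/orP; left; apply/eqP; field; rewrite gt_eqF.
apply: ler_sum => n _.
rewrite (_ : _ + _ = x n *
  (kernel n (z + h) - kernel n z - h * dkernel n z)); last by ring.
rewrite kernel_remainder// [leLHS](_ : _ = normc (x n) * (2 * eps n) * normc h ^+ 2 *
  (normc (pole n - (z + h)) * normc (pole n - z) ^+ 2)^-1); last first.
  by rewrite !expr2 !normcM normcV !normcM np !mulrA.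
rewrite (_ : C / 2 / _ * _ / _ = C / 4 / 2 ^+ n * normc h ^+ 2 *
  (rho / 2 * rho ^+ 2)^-1); last first.
  by field; rewrite expf_neq0// gt_eqF.
have h0 := normc_ge0 h.
apply: ler_pM.
- by rewrite mulr_ge0 ?exprn_ge0// mulr_ge0 ?normc_ge0// -np normc_ge0.
- by rewrite invr_ge0 mulr_ge0 ?exprn_ge0 ?normc_ge0.
- by apply: ler_wpM2r; [rewrite exprn_ge0|exact: xe].
have rho2 : 0 < rho / 2 by lra.
rewrite lef_pV2 ?posrE.
- apply: ler_pM; rewrite ?exprn_ge0 ?(ltW rho2) ?(ltW rho0)//.
  by rewrite lerXn2r ?nnegrE// ?(ltW rho0)// normc_ge0.
- by rewrite mulr_gt0 ?exprn_gt0 ?(lt_le_trans rho2 (pzh n)) ?(lt_le_trans rho0 (pz n)).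
- by rewrite mulr_gt0 ?exprn_gt0.
Qed.

Lemma valL_in (T U : Type) (A : set T) (v : U) (f : A -> U) (a : A) :
  valL_ v f (\val a) = f a.
Proof. exact: (congr1 (fun g => g a) (valLK v f)). Qed.

Lemma synth_holomorphic C x : tempered C x ->
  (fun z : @G1 R => synth x (\val z) : R[i]^o) \in holomorphic_pred G1.
Proof.
move=> xC; apply/asboolP => z.
have Gz : G1 (\val z) by exact: set_mem (valP z).
have [/andP[_ z1] _] := Gz; have [d d0 Gd] := G1_open Gz.
apply: (@derivable_of_remainder _ _ (csum (fun n => x n * dkernel n (\val z)))
  (C / (1 - normc (\val z)) ^+ 3) (Num.min d ((1 - normc (\val z)) / 2))).
  by rewrite lt_min d0 divr_gt0// subr_gt0.
move=> h; rewrite lt_min => /andP[hd hz]; have Gzh := Gd h hd.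
(* At [z + h], still in [G1], the extension by 0 takes the value of the synthesis. *)
have E := @valL_in _ _ _ (0 : R[i]^o) (fun z : @G1 R => synth x (\val z) : R[i]^o)
  (SigSub (mem_set Gzh)).
rewrite /= in E; rewrite [X in X - _ - _]E valL_in.
by apply: synth_remainder => //; exact: ltW.
Qed.

End Holomorphy.

(** * Weights *)

Section SequenceWeights.
Context {R : realType} (lam : nat -> nat -> {posnum R}).
Hypothesis lam_decr : decreasing_weights lam.
Hypothesis lam_bounds : forall k n, 1 / n.+1%:R ^+ 2 <= (lam k n)%:num <= 1.

Definition isq (n : nat) : {posnum R} := (n.+1%:R ^- 2)%:pos.

Lemma isqE n : (isq n)%:num = (sq n)^-1.
Proof. by []. Qed.

Lemma isq_le k n : (isq n)%:num <= (lam k n)%:num.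
Proof. by have /andP[] := lam_bounds k n; rewrite div1r. Qed.

Lemma isq_dominated : dominated lam isq.
Proof. by move=> k; exists 1%:pos => n; rewrite mul1r isq_le. Qed.

Lemma dominatedD (T : Type) (w : nat -> T -> {posnum R}) (v1 v2 : T -> {posnum R}) :
  dominated w v1 -> dominated w v2 ->
  dominated w (fun t => ((v1 t)%:num + (v2 t)%:num)%:pos).
Proof.
move=> h1 h2 k; have [C1 H1] := h1 k; have [C2 H2] := h2 k.
by exists (C1%:num + C2%:num)%:pos => t; rewrite /= mulrDl lerD.
Qed.

Lemma dominated_bounded (mu : nat -> {posnum R}) : dominated lam mu ->
  exists C : {posnum R}, forall n, (mu n)%:num <= C%:num.
Proof.
move=> /(_ 0%N)[C H]; exists C => n; apply: (le_trans (H n)).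
by rewrite ler_piMr//; have /andP[] := lam_bounds 0%N n.
Qed.

Lemma lam_mono k l n : (k <= l)%N -> (lam l n)%:num <= (lam k n)%:num.
Proof.
move=> /subnK <-; elim: (l - k)%N => [//|m IH].
by rewrite addSn (le_trans _ IH)// lam_decr.
Qed.

(* If [lam k * |x|] is unbounded for every [k], pick [s k] with
   [lam k (s k) * |x (s k)| > k] and a weight that is at least [lam k] at every
   [s k]. It is dominated by [lam l]: only the finitely many [s k] with [k < l]
   need a constant, the other values [lam k (s k)] are [<= lam l (s k)]. *)
Lemma K_infty_step (x : nat -> R[i]) :
  (forall mu, dominated lam mu -> has_ubound (weighted_range mu x)) ->
  exists k (M : R), forall n, (lam k n)%:num * normc (x n) <= M.
Proof.
move=> xK; apply: contrapT => nx.
have /choice[s sP] : forall k, exists n, k%:R < (lam k n)%:num * normc (x n).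
  move=> k; apply: contrapT => h; apply: nx; exists k, k%:R => n.
  by rewrite leNgt; apply/negP => hn; apply: h; exists n.
(* The element 0 keeps [S n] nonempty for [n] outside the range of [s]. *)
pose S n : set R := [set a | a = 0 \/ exists2 k, s k = n & a = (lam k n)%:num].
have Sub n a : S n a -> a <= 1.
  by case=> [->|[k _ ->]]; [exact: ler01|have /andP[] := lam_bounds k n].
have Ssup n a : S n a -> a <= sup (S n).
  by move=> Sa; apply: ub_le_sup => //; exists 1 => b; exact: Sub.
have S0 n : 0 <= sup (S n) by apply: Ssup; left.
have mu0 n : 0 < (isq n)%:num + sup (S n) by rewrite ltr_pwDl.
pose mu n := PosNum (mu0 n).
have dmu : dominated lam mu.
  (* One unit of the 2 covers [isq], the other [k >= l]; for [k < l] the summand [sq (s k)]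
     suffices, as [1 = sq n * isq n <= sq n * lam l n]. *)
  move=> l; pose c : R := 2 + \sum_(k < l) sq (s k).
  have c0 : 0 < c by rewrite ltr_pwDl// sumr_ge0// => k _; exact: ltW (sq_gt0 _).
  exists (PosNum c0) => n /=; rewrite /c -addrA mulrDl mul1r.
  apply: lerD; first exact: isq_le.
  have q0 : 0 <= \sum_(k < l) sq (s k) :> R.
    by rewrite sumr_ge0// => k _; exact: ltW (sq_gt0 _).
  apply: ge_sup; first by exists 0; left.
  move=> a [->|[k kn ->]]; first by rewrite mulr_ge0// addr_ge0.
  have [lk|kl] := leqP l k.
    by apply: (le_trans (lam_mono _ lk)); rewrite ler_peMl// lerDl.
  apply: (@le_trans _ _ 1); first by have /andP[] := lam_bounds k n.
  apply: (@le_trans _ _ (sq n * (isq n)%:num)).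
    by rewrite isqE mulfV// gt_eqF// sq_gt0.
  apply: ler_pM; [exact: ltW (sq_gt0 _)|exact: ltW| |exact: isq_le].
  rewrite -kn (bigD1 (Ordinal kl))//= addrCA lerDl addr_ge0//.
  by rewrite sumr_ge0// => i _; exact: ltW (sq_gt0 _).
have [M HM] := xK mu dmu.
(* At an index [k > M] the chosen [s k] violates the bound [M]. *)
have := truncnS_gt M; apply/negP; rewrite -leNgt.
set k := (Num.truncn M).+1; apply: (le_trans (ltW (sP k))).
apply: (le_trans _ (HM _ (ex_intro2 _ _ (s k) I erefl))).
apply: ler_wpM2r; first exact: normc_ge0.
apply: (@le_trans _ _ (sup (S (s k)))); last by rewrite /= lerDr.
by apply: Ssup; right; exists k.
Qed.

End SequenceWeights.

(** * Passing between weights on [G1] and weights on sequences *)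

Section AngularWeights.
Context {R : realType} (lam : nat -> nat -> {posnum R}).
Context (hat : nat -> R -> {posnum R}).
Hypothesis lam_bounds : forall k n, 1 / n.+1%:R ^+ 2 <= (lam k n)%:num <= 1.
Hypothesis hat_profile : angular_profile lam hat.
Notation theta := (@Defs.theta R).
Notation radius := (@Defs.radius R).
Notation w := (angular_weights hat).

Lemma angular_le1 k z : (w k z)%:num <= 1.
Proof.
have [_ /(hat_bounds lam_bounds hat_profile k)/andP[]//] := set_mem (valP z).
Qed.

Lemma W_bar_bounded v : W_bar w v ->
  exists C : {posnum R}, forall z, (v z)%:num <= C%:num.
Proof.
move=> [/(_ 0%N)[C H] _]; exists C => z; apply: (le_trans (H z)).
by rewrite ler_piMr// angular_le1.
Qed.

Definition G1_node_sub n : @G1 R := SigSub (mem_set (G1_node n)).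

(** The weight is [isq n] plus the supremum of [v] over the n-th sector. Each [w k] equals [lam k n]
    there, so domination carries over with almost the same constants. *)
Lemma W_bar_sector v : W_bar w v -> exists2 mu, dominated lam mu &
  forall n, (isq n)%:num <= (mu n)%:num /\
    forall z : G1, `|carg (\val z) - theta n| <= radius n -> (v z)%:num <= (mu n)%:num.
Proof.
move=> [vw _].
pose S n : set R := [set a | exists2 z : @G1 R,
  `|carg (\val z) - theta n| <= radius n & a = (v z)%:num].
have Sub k (C : {posnum R}) n a :
    (forall z, (v z)%:num <= C%:num * (w k z)%:num) -> S n a ->
    a <= C%:num * (lam k n)%:num.
  move=> H [z zn ->]; apply: (le_trans (H z)).
  by rewrite /angular_weights (hat_sector hat_profile k zn).
have Snode n : S n (v (G1_node_sub n))%:num.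
  by exists (G1_node_sub n) => //=; rewrite carg_node subrr normr0 ltW// radius_gt0.
have Ssup n a : S n a -> a <= sup (S n).
  have [C H] := vw 0%N.
  move=> Sa; apply: ub_le_sup => //; exists (C%:num * (lam 0%N n)%:num) => b.
  exact: Sub.
have S0 n : 0 < sup (S n) by apply: lt_le_trans (Ssup _ _ (Snode n)).
have mu0 n : 0 < (isq n)%:num + sup (S n) by rewrite addr_gt0.
exists (fun n => PosNum (mu0 n)).
  move=> k; have [C H] := vw k; exists (1 + C%:num)%:pos => n /=.
  rewrite mulrDl mul1r; apply: lerD; first exact: isq_le.
  apply: ge_sup; first by eexists; exact: Snode.
  by move=> a; exact: Sub.
move=> n; split=> [|z zn] /=; first by rewrite lerDl ltW.
by apply: (@le_trans _ _ (sup (S n))); [apply: Ssup; exists z|rewrite lerDr].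
Qed.

Definition bump n t : R := Num.max 0 (1 - `|t - theta n| / radius n).

Fixpoint bumps (mu : nat -> {posnum R}) M t : R :=
  if M is M.+1 then Num.max (bumps mu M t) ((mu M)%:num * bump M t) else 0.

Lemma bump_ge0 n t : 0 <= bump n t.
Proof. by rewrite le_max lexx. Qed.

Lemma bump_le1 n t : bump n t <= 1.
Proof. by rewrite ge_max ler01 gerBl divr_ge0// ltW// radius_gt0. Qed.

Lemma bump_out n t : radius n <= `|t - theta n| -> bump n t = 0.
Proof.
by move=> h; apply/max_idPl; rewrite subr_le0 ler_pdivlMr ?radius_gt0// mul1r.
Qed.

Lemma bump_theta n : bump n (theta n) = 1.
Proof. by rewrite /bump subrr normr0 mul0r subr0; apply/max_idPr. Qed.

Lemma bumps_ge0 mu M t : 0 <= bumps mu M t.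
Proof. by case: M => //= M; rewrite le_max mulr_ge0 ?bump_ge0 ?orbT. Qed.

Lemma bumps_le mu M t (B : R) : 0 <= B ->
  (forall n, (mu n)%:num * bump n t <= B) -> bumps mu M t <= B.
Proof. by move=> B0 h; elim: M => //= M IH; rewrite ge_max IH h. Qed.

Lemma bumps_ge mu M t n : (n < M)%N -> (mu n)%:num * bump n t <= bumps mu M t.
Proof.
elim: M => // M IH; rewrite ltnS leq_eqVlt /= le_max => /orP[/eqP ->|/IH ->//].
by rewrite lexx orbT.
Qed.

(** From index [M] on, [peak n <= 1 / n.+1%:R <= t], so those tents vanish at [t]. *)
Lemma bumps_stable mu M k t : 0 < t -> t^-1 <= M.+1%:R ->
  bumps mu (M + k) t = bumps mu M t.
Proof.
move=> t0 tM; elim: k => [|k IH]; first by rewrite addn0.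
rewrite addnS /= IH bump_out ?mulr0; first by apply/max_idPl; exact: bumps_ge0.
have [_ _ s3 s4] := @sector_bounds R (M + k)%N.
suff h : 1 / (M + k).+1%:R <= t.
  rewrite ler_normr; apply/orP; left.
  by rewrite lerBrDr addrC (le_trans (ltW s3))// (le_trans s4).
rewrite mul1r -[t]invrK lef_pV2 ?posrE ?invr_gt0// (le_trans tM)//.
by rewrite ler_nat ltnS leq_addr.
Qed.

Lemma continuous_bump n : continuous (bump n).
Proof.
move=> t; apply: (@continuous_max _ _ (fun=> 0)
  (fun t => 1 - `|t - theta n| / radius n) t).
  exact: cvg_cst.
apply: cvgB; first exact: cvg_cst.
apply: cvgM; last exact: cvg_cst.
by apply: cvg_norm; apply: cvgB; [exact: cvg_id|exact: cvg_cst].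
Qed.

Lemma continuous_bumps mu M : continuous (bumps mu M).
Proof.
elim: M => [|M IH] t /=; first exact: cvg_cst.
apply: (@continuous_max _ _ (bumps mu M) (fun t => (mu M)%:num * bump M t) t).
  exact: IH.
by apply: cvgM; [exact: cvg_cst|exact: continuous_bump].
Qed.

(** The supremum of all tents of height [mu n], cut off where [bumps_stable] shows that nothing is
    lost. The term [t ^+ 2 / 16] makes it positive and, by [hat_bounds], stays below every [w k]. *)
Definition fan mu t : R := t ^+ 2 / 16 + bumps mu (Num.truncn t^-1) t.

Lemma fanE mu M t : 0 < t -> t^-1 <= M%:R -> fan mu t = t ^+ 2 / 16 + bumps mu M t.
Proof.
move=> t0 tM; rewrite /fan; congr (_ + _).
have TM : (Num.truncn t^-1 <= M)%N.
  rewrite -(ler_nat R); apply: le_trans tM; rewrite truncn_le.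
  by rewrite invr_ge0 ltW.
rewrite -(subnKC TM) bumps_stable//; exact: ltW (truncnS_gt _).
Qed.

Lemma fan_gt0 mu t : 0 < t -> 0 < fan mu t.
Proof. by move=> t0; rewrite ltr_pwDl ?bumps_ge0// divr_gt0// exprn_gt0. Qed.

Lemma continuous_carg_val (z : @G1 R) :
  {for z, continuous (fun z : @G1 R => carg (\val z))}.
Proof.
apply: (@continuous_comp (@G1 R) R[i]^o R _ (@carg R)).
  exact: initial_continuous.
exact: continuous_carg (set_mem (valP z)).
Qed.

Lemma carg_gt0 (z : @G1 R) : 0 < carg (\val z).
Proof. by have [_ /andP[]] := set_mem (valP z). Qed.

Definition fan_weight mu (z : @G1 R) : {posnum R} :=
  PosNum (fan_gt0 mu (carg_gt0 z)).

Lemma continuous_fan mu : continuous (fun z : @G1 R => fan mu (carg (\val z))).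
Proof.
move=> z; set t := carg (\val z); have t0 : 0 < t := carg_gt0 z.
(* One cutoff valid for all angles above [t / 2], so that near [z] the fan is a fixed finite maximum
   of tents. *)
pose M := (Num.truncn (2 / t)).+1.
have near_t : \forall z' \near z, t / 2 < carg (\val z').
  have /cvgr_gt := @continuous_carg_val z; apply; rewrite /= -/t; lra.
have E : \forall z' \near z, carg (\val z') ^+ 2 / 16 + bumps mu M (carg (\val z'))
    = fan mu (carg (\val z')).
  apply: (@filterS _ _ (nbhs_filter z) _ _ _ near_t) => z' h.
  apply/esym/fanE; first exact: carg_gt0.
  apply: ltW; apply: lt_le_trans (ltW (truncnS_gt _)).
  by rewrite -[2 / t]invrK ltf_pV2 ?posrE ?invr_gt0 ?divr_gt0 ?carg_gt0// invf_div.
rewrite /continuous_at -(nbhs_singleton E).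
apply: (cvg_trans (@near_eq_cvg _ _ _ (nbhs_filter z) _ _ E)).
apply: cvgD.
  apply: cvgM; last exact: cvg_cst.
  by rewrite expr2; apply: cvgM; exact: continuous_carg_val.
apply: (@continuous_comp (@G1 R) R R (fun z => carg (\val z)) (bumps mu M)).
  exact: continuous_carg_val.
exact: continuous_bumps.
Qed.

Lemma fan_weight_W_bar mu : dominated lam mu -> W_bar w (fan_weight mu).
Proof.
move=> dmu; split; last exact: continuous_fan.
move=> k; have [C H] := dmu k; exists (1 + C%:num)%:pos => z /=.
have [_ /(hat_bounds lam_bounds hat_profile k)/andP[h1 _]] := set_mem (valP z).
rewrite mulrDl mul1r; apply: lerD => //; apply: bumps_le => // n.
have [zn|/ltW zn] := leP `|carg (\val z) - theta n| (radius n); last first.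
  by rewrite bump_out// mulr0.
rewrite /angular_weights (hat_sector hat_profile k zn).
by apply: le_trans (H n); rewrite ler_piMr// bump_le1.
Qed.

Lemma fan_weight_node mu n : (mu n)%:num <= (fan_weight mu (G1_node_sub n))%:num.
Proof.
rewrite /= carg_node; have /andP[t0 _] := @theta_itv R n.
(* The cutoff must exceed both [(theta n)^-1], for [fanE], and [n], so that the n-th tent is
   included. *)
have tM : (theta n)^-1 <= ((Num.truncn (theta n)^-1).+1 + n.+1)%:R.
  by rewrite (le_trans (ltW (truncnS_gt _)))// ler_nat leq_addr.
rewrite (fanE _ t0 tM); apply: le_trans (_ : bumps mu _ (theta n) <= _).
  have := @bumps_ge mu _ (theta n) n (_ : (n < (Num.truncn (theta n)^-1).+1 + n.+1)%N).
  by rewrite bump_theta mulr1; apply; rewrite addnS ltnS leq_addl.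
by rewrite lerDr divr_ge0 ?sqr_ge0.
Qed.

End AngularWeights.

(** * The complemented copy *)

Section Isomorphism.
Context {R : realType} (lam : nat -> nat -> {posnum R}).
Context (hat : nat -> R -> {posnum R}).
Hypothesis lam_bounds : forall k n, 1 / n.+1%:R ^+ 2 <= (lam k n)%:num <= 1.
Hypothesis hat_profile : angular_profile lam hat.
Notation theta := (@Defs.theta R).
Notation radius := (@Defs.radius R).
Notation w := (angular_weights hat).
Notation Kseq := (fsubspace (weighted_pred (@all_pred R) (dominated lam))).
Notation Hol := (fsubspace (weighted_pred (holomorphic_pred (@G1 R)) (W_bar w))).

Lemma tempered_of_weight (mu : nat -> {posnum R}) (x : nat -> R[i]) (M : R) :
  (forall n, (isq n)%:num <= (mu n)%:num) ->
  (forall n, (mu n)%:num * normc (x n) <= M) -> tempered M x.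
Proof.
move=> mu_isq xM n; rewrite -ler_pdivrMr ?sq_gt0// mulrC -isqE.
by apply: le_trans (xM n); apply: ler_wpM2r (mu_isq n); exact: normc_ge0.
Qed.

Lemma synth_weight (v : @G1 R -> {posnum R}) (mu : nat -> {posnum R})
    (x : nat -> R[i]) (V M : R) :
  (forall z, (v z)%:num <= V) ->
  (forall n, (isq n)%:num <= (mu n)%:num /\
    forall z : G1, `|carg (\val z) - theta n| <= radius n -> (v z)%:num <= (mu n)%:num) ->
  (forall n, (mu n)%:num * normc (x n) <= M) ->
  forall z, (v z)%:num * normc (synth x (\val z)) <= (V / 4 + 2) * M.
Proof.
move=> vV vmu xM z.
have xT := tempered_of_weight (fun n => (vmu n).1) xM.
have M0 := tempered_ge0 xT.
have Gz : G1 (\val z) := set_mem (valP z).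
apply: (@le_trans _ _ ((v z)%:num * (M / 4) + 2 * M)).
  apply: (synth_le xT Gz) => // n zn; apply: le_trans (xM n).
  by apply: ler_wpM2r; [exact: normc_ge0|exact: (vmu n).2].
by have := vV z; nra.
Qed.

(** The samples are bounded by [M] in the weight [mu]; the correction [coef y - y] is bounded by [M]
    unweighted, which costs the factor [V]. *)
Lemma coef_weight (v : @G1 R -> {posnum R}) (mu : nat -> {posnum R})
    (f : @G1 R -> R[i]) (V M : R) :
  (forall n, (mu n)%:num <= V) ->
  (forall n, (isq n)%:num <= (v (G1_node_sub n))%:num) ->
  (forall n, (mu n)%:num <= (v (G1_node_sub n))%:num) ->
  (forall z, (v z)%:num * normc (f z) <= M) ->
  forall n, (mu n)%:num * normc (coef (f \o @G1_node_sub R) n) <= (1 + V) * M.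
Proof.
move=> muV v_isq v_mu fM n; set y := f \o _.
have yT : tempered M y.
  by apply: (@tempered_of_weight (v \o @G1_node_sub R)) => // k; exact: fM.
have M0 := tempered_ge0 yT.
have h1 := le_normcD (coef y n - y n) (y n); rewrite subrK in h1.
have h2 := coef_diff n yT.
have h3 : (mu n)%:num * normc (y n) <= M.
  apply: le_trans (fM (G1_node_sub n)).
  by apply: ler_wpM2r; [exact: normc_ge0|exact: v_mu].
have h4 := muV n.
apply: (@le_trans _ _ ((mu n)%:num * (M + normc (y n)))).
  by apply: ler_wpM2l => //; apply: (le_trans h1); rewrite lerD2r.
rewrite mulrDr mulrDl mul1r addrC; apply: lerD => //.
by apply: ler_wpM2r.
Qed.

Lemma Kseq_le (x : Kseq) mu : dominated lam mu ->
  forall n, (mu n)%:num * normc (x n) <= weighted_sup mu x.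
Proof.
by move=> dmu n; apply: weighted_sup_ub; exact: weighted_space_bounded dmu.
Qed.

Lemma Hol_le (f : Hol) v : W_bar w v ->
  forall z, (v z)%:num * normc (f z) <= weighted_sup v f.
Proof.
by move=> dv z; apply: weighted_sup_ub; exact: weighted_space_bounded dv.
Qed.

Lemma Kseq_tempered (x : Kseq) : exists C, tempered C x.
Proof.
exists (weighted_sup (isq (R := R)) x); apply: (@tempered_of_weight (isq (R := R))) => //.
by apply: Kseq_le; exact: isq_dominated.
Qed.

Lemma synth_bound v : W_bar w v -> exists mu (C : R), dominated lam mu /\
  forall (x : nat -> R[i]) M, (forall n, (mu n)%:num * normc (x n) <= M) ->
    forall z, (v z)%:num * normc (synth x (\val z)) <= C * M.
Proof.
move=> vW; have [V vV] := W_bar_bounded lam_bounds hat_profile vW.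
have [mu dmu vmu] := W_bar_sector lam_bounds hat_profile vW.
by exists mu, (V%:num / 4 + 2); split => // x M; exact: synth_weight.
Qed.

Lemma coef_bound mu : dominated lam mu -> exists v (C : R), W_bar w v /\
  forall f M, (forall z, (v z)%:num * normc (f z) <= M) ->
    tempered M (f \o @G1_node_sub R) /\
    forall n, (mu n)%:num * normc (coef (f \o @G1_node_sub R) n) <= C * M.
Proof.
move=> dmu; have [V muV] := dominated_bounded lam_bounds dmu.
(* Adding [isq] forces the samples to be tempered, so that [coef] is meaningful on them. *)
have dnu := dominatedD dmu (isq_dominated lam_bounds).
set nu := (fun n => _) in dnu.
exists (fan_weight nu), (1 + V%:num); split; first exact: fan_weight_W_bar dnu.
have v_isq n : (isq n)%:num <= (fan_weight nu (G1_node_sub n))%:num.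
  by apply: le_trans (fan_weight_node _ _); rewrite /= lerDr.
move=> f M fM; split.
  apply: (@tempered_of_weight (fan_weight nu \o @G1_node_sub R)) => // n.
  exact: fM.
apply: coef_weight fM => // n.
by apply: le_trans (fan_weight_node _ _); rewrite /= lerDl.
Qed.

Lemma synth_mem (x : Kseq) :
  (fun z : @G1 R => synth x (\val z) : R[i]^o)
    \in weighted_pred (holomorphic_pred G1) (W_bar w).
Proof.
have [C xC] := Kseq_tempered x.
rewrite inE (synth_holomorphic xC); apply/asboolP => v vW.
have [mu [C' [dmu H]]] := synth_bound vW.
exists (C' * weighted_sup mu x) => _ [z _ <-]; apply: H.
exact: Kseq_le.
Qed.

Definition Ksynth (x : Kseq) : Hol := FSubspace (synth_mem x).

Lemma Hol_tempered (f : Hol) : exists C, tempered C (f \o @G1_node_sub R).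
Proof.
have [v [C [vW H]]] := coef_bound (isq_dominated lam_bounds).
by exists (weighted_sup v f); have [] := H f _ (Hol_le f vW).
Qed.

Lemma coef_mem (f : Hol) :
  (coef (f \o @G1_node_sub R) : nat -> R[i]^o)
    \in weighted_pred (@all_pred R) (dominated lam).
Proof.
apply/andP; split=> //; apply/asboolP => mu dmu.
have [v [C [vW H]]] := coef_bound dmu.
exists (C * weighted_sup v f) => _ [n _ <-].
by have [_] := H f _ (Hol_le f vW); apply.
Qed.

Definition Hcoef (f : Hol) : Kseq := FSubspace (coef_mem f).

Lemma Ksynth_linear : linear Ksynth.
Proof.
move=> a x y; apply: val_inj; apply/funext => z /=.
have [C xC] := Kseq_tempered x; have [C' yC] := Kseq_tempered y.
have [/andP[_ z1] _] : G1 (\val z) := set_mem (valP z).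
exact: (synthZD a xC yC z1).
Qed.

Lemma Hcoef_linear : linear Hcoef.
Proof.
move=> a f h; apply: val_inj => /=.
have [C fC] := Hol_tempered f; have [C' hC] := Hol_tempered h.
exact: (coefZD a fC hC).
Qed.

HB.instance Definition _ :=
  GRing.isLinear.Build R[i] Kseq Hol *:%R Ksynth Ksynth_linear.
HB.instance Definition _ :=
  GRing.isLinear.Build R[i] Hol Kseq *:%R Hcoef Hcoef_linear.

Lemma KsynthK : cancel Ksynth Hcoef.
Proof.
move=> x; apply: val_inj => /=; have [C xC] := Kseq_tempered x.
exact: (coef_unique xC).
Qed.

Lemma Ksynth_continuous :
  continuous (Ksynth : K_infty lam -> HW_bar w).
Proof.
apply: lc_continuous => [x y|_ [v [vW ->]]]; first exact: raddfB.
have [mu [C [dmu H]]] := synth_bound vW.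
exists (weight_seminorm _ dmu), C; split; first by exists mu, dmu.
move=> x /=; apply: weighted_sup_le; last by apply: H; exact: Kseq_le.
apply: le_trans (H x _ (Kseq_le x dmu) (G1_node_sub 0)).
by rewrite mulr_ge0 ?normc_ge0.
Qed.

Lemma Hcoef_continuous :
  continuous (Hcoef : HW_bar w -> K_infty lam).
Proof.
apply: lc_continuous => [x y|_ [mu [dmu ->]]]; first exact: raddfB.
have [v [C [vW H]]] := coef_bound dmu.
exists (weight_seminorm _ vW), C; split; first by exists v, vW.
move=> f /=; have [_ Hf] := H f _ (Hol_le f vW).
apply: weighted_sup_le => //; apply: le_trans (Hf 0%N).
by rewrite mulr_ge0 ?normc_ge0.
Qed.

(** [Hcoef] is a continuous left inverse of [Ksynth], so [Ksynth \o Hcoef] is a continuous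
    projection onto the range of [Ksynth]. *)
Lemma HW_bar_complemented : exists S : set (HW_bar w),
  complemented S /\ isomorphic_to_subspace (K_infty lam) S.
Proof.
exists (range Ksynth); split.
  exists (Ksynth \o Hcoef : {linear Hol -> Hol}); split.
  - move=> f; apply: (@continuous_comp (HW_bar w) (K_infty lam) (HW_bar w) Hcoef Ksynth);
      [exact: Hcoef_continuous|exact: Ksynth_continuous].
  - by move=> f /=; rewrite KsynthK.
  - apply/seteqP; split=> [_ [f _ <-]|_ [x _ <-]]; first by exists (Hcoef f).
    by exists (Ksynth x) => //=; rewrite KsynthK.
exists (Ksynth : {linear Kseq -> Hol}), Hcoef; split => //.
- exact: Ksynth_continuous.
- exact: KsynthK.
- by apply: continuous_subspaceT; exact: Hcoef_continuous.
Qed.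

End Isomorphism.

(** * Failure of the topological equality *)

Section BornologicalObstruction.
Context {R : realType} (lam : nat -> nat -> {posnum R}).
Context (hat : nat -> R -> {posnum R}).
Hypothesis lam_decr : decreasing_weights lam.
Hypothesis lam_bounds : forall k n, 1 / n.+1%:R ^+ 2 <= (lam k n)%:num <= 1.
Hypothesis hat_profile : angular_profile lam hat.
Notation w := (angular_weights hat).
Notation Kseq := (fsubspace (weighted_pred (@all_pred R) (dominated lam))).
Let dw := angular_weights_decreasing lam_decr hat_profile.
Notation Union := (fsubspace (union_pred (holomorphic_pred (@G1 R)) dw)).

Notation incl := (@WH_to_HW_bar R w dw).

Let g : Union -> Kseq := Hcoef lam_bounds hat_profile \o incl.

Let g_linear : linear g.
Proof.
move=> a f h; rewrite /g /=; have -> : incl (a *: f + h) =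
    a *: incl f + incl h by exact: val_inj.
exact: linearP.
Qed.

Lemma comp_seminormD (E F : lmodType R[i]) (L : E -> F) (p : seminorm F) :
  linear L -> forall x y, p (L (x + y)) <= p (L x) + p (L y).
Proof. by move=> lL x y; have := lL 1 x y; rewrite !scale1r => ->; exact: seminormD. Qed.

Lemma comp_seminormZ (E F : lmodType R[i]) (L : E -> F) (p : seminorm F) :
  linear L -> forall a x, p (L (a *: x)) = normc a * p (L x).
Proof.
move=> lL a x; have L0 : L 0 = 0.
  by have := lL (-1) 0 0; rewrite scaler0 addr0 scaleN1r addNr.
by have := lL a x 0; rewrite L0 !addr0 => ->; exact: seminormZ.
Qed.

Definition comp_seminorm (E F : lmodType R[i]) (L : E -> F) (lL : linear L)
    (p : seminorm F) : seminorm E :=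
  Seminorm (comp_seminormD p lL) (comp_seminormZ p lL).

(** By [K_infty_step], [x] is bounded in a single weight [lam k]; [synth_weight] with [v = w k] then
    puts its synthesis in the k-th step. *)
Lemma Ksynth_union (x : Kseq) : exists f : Union,
  incl f = Ksynth lam_bounds hat_profile x.
Proof.
have xK mu : dominated lam mu -> has_ubound (weighted_range mu x).
  by move=> dmu; exact: weighted_space_bounded dmu.
have [k [M xM]] := K_infty_step lam_decr lam_bounds xK.
have h := synth_weight (v := w k) (mu := lam k) (V := 1)
  (angular_le1 lam_bounds hat_profile k) _ xM.
have fU : (fun z : @G1 R => synth x (\val z) : R[i]^o)
    \in union_pred (holomorphic_pred (@G1 R)) dw.
  apply/asboolP; exists k; have [C xC] := Kseq_tempered lam_bounds x.
  rewrite inE (synth_holomorphic xC); apply/asboolP => _ ->.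
  exists ((1 / 4 + 2) * M) => _ [z _ <-]; apply: h => n.
  split=> [|z' zn]; first exact: isq_le.
  by rewrite /angular_weights (hat_sector hat_profile k zn).
by exists (FSubspace fU); exact: val_inj.
Qed.

(** Homogeneity, applied to [x / d] with [d] slightly larger than [p x], which also covers
    [p x = 0]. *)
Lemma le_eps_seminorm (E : lmodType R[i]) (p q : seminorm E) (t : R) :
  0 <= t -> (forall x, p x <= 1 -> q x <= t) -> forall x, q x <= t * p x.
Proof.
move=> t0 pq x; apply/ler_addgt0Pl => e e0.
pose d := p x + e / (t + 1).
have t1 : 0 < t + 1 by rewrite ltr_wpDl.
have d0 : 0 < d by rewrite ltr_wpDl ?seminorm_ge0// divr_gt0.
have := pq (d^-1%:C *: x).
rewrite !seminormZ normc_real gtr0_norm ?invr_gt0// !ler_pdivrMl// mulr1.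
have -> : p x <= d by rewrite /d lerDl ltW// divr_gt0.
move=> /(_ isT) /le_trans; apply.
rewrite /d mulrDl addrC [p x * t]mulrC lerD2r mulrAC ler_pdivrMr//.
by apply: ler_wpM2l; [exact: ltW|rewrite lerDl].
Qed.

Lemma coincide_bornological : coincide_topologically dw -> bornological (K_infty lam).
Proof.
move=> coin D Dconv Dborn.
have Dc (a b : R[i]) (x y : Kseq) : normc a + normc b <= 1 -> D x -> D y ->
    D (a *: x + b *: y).
  move=> ab; apply: (Dconv a b); rewrite !normc_of_norm.
  by rewrite -rmorphD lecR.
have absorbed (B : set Kseq) : von_neumann_bounded (B : set (K_infty lam)) ->
    exists2 t : R, 0 < t & forall x, B x -> D ((t^-1)%:C *: x).
  move=> /Dborn[r r0 H].
  have [t tE] : exists t : R, r = t%:C.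
    by apply/complex_realP; rewrite realE ltW.
  move: r0 H; rewrite {}tE ltcR => t0 H; exists t => // x Bx.
  have [|y Dy <-] := H t%:C _ x Bx.
    by rewrite normc_of_norm normc_real gtr0_norm.
  have tn0 : t%:C != 0 :> R[i] by rewrite eq_complex /= eqxx andbT gt_eqF.
  by rewrite scalerA -realcM mulVf ?gt_eqF// scale1r.
have Da x : exists2 t : R, 0 < t & D ((t^-1)%:C *: x).
  have [|t t0 H] := absorbed [set x]; last by exists t => //; apply: H.
  by apply: lc_bounded => p _; exists (p x) => _ ->.
(* The gauge of [D] transported to the union by the left inverse of the synthesis. *)
pose q := comp_seminorm g_linear (gauge_seminorm Dc Da).
have qstep k : continuous
    ((q \o inclusion (@step_union _ _ _ _ dw k)) :
      weighted_step (holomorphic_pred (@G1 R)) w k -> R).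
  pose p : seminorm (fsubspace (step_pred (holomorphic_pred (@G1 R)) w k)) :=
    weight_seminorm _ (erefl : [set w k] (w k)).
  have incl_linear :
      linear (inclusion (@step_union _ _ (holomorphic_pred (@G1 R)) _ dw k)).
    by move=> a f h; exact: val_inj.
  pose qk := comp_seminorm incl_linear q.
  (* The image of the unit ball of the k-th step is bounded in [K_infty], hence absorbed by [D];
     this bounds [q] by a multiple of the norm of the step. *)
  pose B : set Kseq := [set g (inclusion (@step_union _ _ _ _ dw k) f) | f in
    [set f | p f <= 1]].
  have [|t t0 H] := absorbed B.
    apply: lc_bounded => _ [mu [dmu ->]].
    have [v [C [[vw vc] Hv]]] := coef_bound lam_bounds hat_profile dmu.
    have [C' vC'] := vw k.
    exists (C * (C'%:num * 1)) => _ [f /= pf <-] /=.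
    have fv z : (v z)%:num * normc (f z) <= C'%:num * 1.
      apply: (@le_trans _ _ (C'%:num * ((w k z)%:num * normc (f z)))).
        by rewrite mulrA; apply: ler_wpM2r; [exact: normc_ge0|exact: vC'].
      apply: ler_wpM2l => //; apply: le_trans pf.
      by apply: weighted_sup_ub; exact: weighted_space_bounded.
    have [_ Hf] := Hv f _ fv.
    apply: weighted_sup_le => //; apply: le_trans (Hf 0%N).
    by rewrite mulr_ge0 ?normc_ge0.
  have qp : forall f, qk f <= t * p f.
    apply: le_eps_seminorm => [|f pf]; first exact: ltW.
    by apply: gauge_le => //; apply: H; exists f.
  apply: (@lc_continuous_real _ _ _ _ p t); first by exists (w k), erefl.
  move=> f h; rewrite ler_norml; apply/andP; split.
    have := seminormD qk (h - f) f; rewrite subrK.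
    have := qp (f - h); rewrite -opprB seminormN /=; lra.
  have := seminormD qk (f - h) h; rewrite subrK.
  have := qp (f - h); rewrite /=; lra.
(* [q] is one of the seminorms defining [WH], so [U] is open; coincidence makes it the trace of an
   open [V] of [HW_bar]. *)
pose U : set (WH dw) := [set f | q f < 1].
have Uo : open U.
  rewrite openE => f /= qf.
  exists 1%N, (fun=> q), (1 - q f); split => //; first by rewrite subr_gt0.
  move=> h /(_ ord0); have := seminormD q (h - f) f; rewrite subrK /U /=; lra.
move: Uo; rewrite coin => -[V Vo UV].
have V0 : V (Ksynth lam_bounds hat_profile 0).
  have : U 0 by rewrite /U /mkset (seminorm0 q) ltr01.
  rewrite -UV /= (_ : incl 0 = Ksynth lam_bounds hat_profile 0)//.
  by rewrite raddf0; exact: val_inj.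
have : nbhs (Ksynth lam_bounds hat_profile 0 : HW_bar w) V.
  by move: Vo; rewrite openE; apply.
have cA := @Ksynth_continuous R lam hat lam_bounds hat_profile 0.
move=> /cA VA; apply: (@filterS _ _ (nbhs_filter (0 : K_infty lam)) _ _ _ VA) => x /= Vx.
(* [V] is known only through its trace on the union, so [Ksynth x] is lifted to [f]; then [q f] is
   the gauge of [x]. *)
have [f fE] := Ksynth_union x.
have : U f by rewrite -UV /= fE.
rewrite /U /= => /(gauge_lt1 Dc Da).
by rewrite /g /= fE KsynthK.
Qed.

End BornologicalObstruction.

Theorem theorem3 (R : realType) (lam : nat -> nat -> {posnum R})
    (lam_decr : decreasing_weights lam)
    (lam_bounds : forall k n, 1 / n.+1%:R ^+ 2 <= (lam k n)%:num <= 1)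
    (K_infty_not_bornological : ~ bornological (K_infty lam))
    (K_infty_not_metrizable : exists B : set (K_infty lam),
       von_neumann_bounded B /\ ~ metrizable_subset R B)
    (hat : nat -> R -> {posnum R}) (hat_profile : angular_profile lam hat) :
  (exists S : set (HW_bar (angular_weights hat)),
     complemented S /\ isomorphic_to_subspace (K_infty lam) S) /\
  ~ coincide_topologically (angular_weights_decreasing lam_decr hat_profile).
Proof.
split; first exact: HW_bar_complemented.
by move=> /(coincide_bornological lam_bounds).
Qed.
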